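(* Let $K\subset\mathbb{R}^d$ be a measurable set with non-empty interior, let $\rho\colon K\to[0,\infty)$ be Lebesgue-integrable with $\int_K\rho(x)\,\mathrm{d}x>0$, and let $\pi$ be the probability measure on $K$ given by $\pi(A)=\int_A\rho(x)\,\mathrm{d}x\big/\int_K\rho(x)\,\mathrm{d}x$. For $t>0$ let $K(t)=\{x\in K\mid\rho(x)\ge t\}$. For every $t>0$ with $\mathrm{vol}_d(K(t))>0$ let $U_t$ be the uniform distribution on $K(t)$, and let $R_t$ be a Markov kernel on $K(t)$ that is reversible with respect to $U_t$ and whose Markov operator is positive on $L_2(U_t)$; assume that $(x,t)\mapsto R_t(x,A\cap K(t))$ is jointly measurable for every measurable $A\subset K$. Then the Markov operator $R$ of the slice sampler, defined for $f\in L_2(\pi)$ by $$Rf(x)=\frac{1}{\rho(x)}\int_0^{\rho(x)}\int_{K(t)}f(y)\,R_t(x,\mathrm{d}y)\,\mathrm{d}t ,$$ is a positive operator on $L_2(\pi)$.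
   Context: For a probability measure $\nu$, $L_2(\nu)$ is the real Hilbert space of ($\nu$-a.e. equivalence classes of) $\nu$-square-integrable real functions with inner product $\langle f,g\rangle_\nu=\int f g\,\mathrm{d}\nu$. A Markov kernel $Q$ is identified with its Markov operator $Qf(x)=\int f(y)\,Q(x,\mathrm{d}y)$. The kernel $Q$ is reversible with respect to $\nu$ if $\int_A Q(x,A')\,\nu(\mathrm{d}x)=\int_{A'}Q(x,A)\,\nu(\mathrm{d}x)$ for all measurable $A,A'$; then its Markov operator is self-adjoint on $L_2(\nu)$. A self-adjoint operator $P$ on $L_2(\nu)$ is called positive if $\langle Pf,f\rangle_\nu\ge0$ for all $f\in L_2(\nu)$. $\mathrm{vol}_d$ is $d$-dimensional Lebesgue measure. By integrability of $\rho$, $\mathrm{vol}_d(K(t))<\infty$ for every $t>0$, and $U_t(A)=\mathrm{vol}_d(A\cap K(t))/\mathrm{vol}_d(K(t))$. $Rf$ is understood as defined $\pi$-almost everywhere; for $\pi$-a.e. $x$ one has $\rho(x)>0$ and $\mathrm{vol}_d(K(t))>0$ for a.e. $t\in(0,\rho(x)]$, so that the formula makes sense. *)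

(* Defs.v *)
From HB Require Import structures.
From mathcomp Require Import all_boot all_order all_algebra.
From mathcomp Require Import all_classical all_reals all_analysis.
(* not re-exported by all_analysis; it holds the sigma-algebra of \bar R *)
From mathcomp Require Import measurable_realfun.

Set Implicit Arguments.
Unset Strict Implicit.
Unset Printing Implicit Defensive.

Import Order.TTheory GRing.Theory Num.Theory.
Import numFieldNormedType.Exports.

Local Open Scope classical_set_scope.
Local Open Scope ring_scope.

(* R^d is [d.-tuple R] with its Borel (= product) sigma-algebra.  Lebesgue
   measure on it is the iterated product of [lebesgue_measure], transported
   along (x, y) |-> x :: y. *)
Definition tcons (R : realType) (n : nat) (p : R * n.-tuple R) :
  n.+1.-tuple R := [tuple of p.1 :: p.2].

Lemma measurable_tcons (R : realType) (n : nat) :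
  measurable_fun [set: R * n.-tuple R] (@tcons R n).
Proof. exact: measurable_cons. Qed.

Section vol_step.
Context {R : realType} (n : nat).
Variable mu : {sigma_finite_measure set (n.-tuple R) -> \bar R}.
Local Open Scope ereal_scope.

Definition vol_step : set (n.+1.-tuple R) -> \bar R :=
  pushforward (@lebesgue_measure R \x mu) (@tcons R n).

Let vol_step0 : vol_step set0 = 0.
Proof. by rewrite /vol_step /pushforward preimage_set0 measure0. Qed.

Let vol_step_ge0 A : 0 <= vol_step A.
Proof. exact: (measure_ge0 (@lebesgue_measure R \x mu)). Qed.

Let vol_step_sigma_additive : semi_sigma_additive vol_step.
Proof.
have mt (A : set (n.+1.-tuple R)) : measurable A ->
    measurable (@tcons R n @^-1` A).
  by move=> mA; rewrite -[X in measurable X]setTI; exact: measurable_tcons.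
move=> F mF tF mUF; rewrite /vol_step /pushforward preimage_bigcup.
apply: measure_semi_sigma_additive => [k||].
- exact: mt.
- apply/trivIsetP => /= i j _ _ ij; rewrite -preimage_setI.
  by move/trivIsetP : tF => /(_ _ _ _ _ ij) ->//; rewrite preimage_set0.
- by rewrite -preimage_bigcup; exact: mt.
Qed.

HB.instance Definition _ := isMeasure.Build _ _ _ vol_step
  vol_step0 vol_step_ge0 vol_step_sigma_additive.

Let vol_step_sigma_finite : sigma_finite setT vol_step.
Proof.
have /sigma_finiteP[F [FT ndF Foo]] := sigma_finiteT (@lebesgue_measure R).
have /sigma_finiteP[G [GT ndG Goo]] := sigma_finiteT mu.
pose g (u : n.+1.-tuple R) : R * n.-tuple R := (thead u, [tuple of behead u]).
have mg : measurable_fun setT g.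
  apply: measurable_fun_pair; last exact: measurable_behead.
  exact: measurable_tnth.
have gK : cancel (@tcons R n) g.
  by case=> x y; congr pair; exact/val_inj.
exists (fun k => g @^-1` (F k `*` G k)).
  rewrite -preimage_bigcup (_ : \bigcup_k _ = setT) ?preimage_setT//.
  apply/seteqP; split=> // -[x y] _.
  have [i _ Fix] : (\bigcup_i F i) x by rewrite -FT.
  have [j _ Gjy] : (\bigcup_j G j) y by rewrite -GT.
  exists (maxn i j) => //; split => /=.
  - by move: x Fix; exact/subsetPset/ndF/leq_maxl.
  - by move: y Gjy; exact/subsetPset/ndG/leq_maxr.
move=> k; have [mF Fk] := Foo k; have [mG Gk] := Goo k; split.
  by rewrite -[X in measurable X]setTI; apply: mg => //; exact: measurableX.
rewrite /vol_step /pushforward (_ : _ @^-1` _ = F k `*` G k); last first.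
  by apply/seteqP; split=> p; rewrite /preimage /mkset gK.
by rewrite product_measure1E// lte_mul_pinfty// ge0_fin_numE.
Qed.

HB.instance Definition _ := Measure_isSigmaFinite.Build _ _ _ vol_step
  vol_step_sigma_finite.

End vol_step.

Fixpoint vol (R : realType) (d : nat) :
    {sigma_finite_measure set (d.-tuple R) -> \bar R} :=
  if d is n.+1 then vol_step (vol R n)
  else @dirac _ (0.-tuple R) [tuple] R.

(* The tuple type carries no topology in the library; the (usual) topology
   of R^d is taken from row vectors. *)
Definition has_interior (R : realType) (d : nat) (K : set (d.-tuple R)) :=
  [set v : 'rV[R]_d | K [tuple v ord0 i | i < d]]^° !=set0.

(* The probability measures below live on a measurable subset S of the ambient
   space; they are represented by measures on the whole space for which the
   complement of S is negligible. *)

(* A |-> \int_(A `&` D) f dmu *)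
Section density.
Context d (T : measurableType d) (R : realType).
Variables (mu : {measure set T -> \bar R}) (D : set T) (f : T -> R).
Variables (mD : measurable D) (intf : mu.-integrable D (EFin \o f)).
Variable f0 : forall x, D x -> 0 <= f x.
Local Open Scope ereal_scope.

Definition density of measurable D & mu.-integrable D (EFin \o f)
    & (forall x, D x -> (0 <= f x)%R) : set T -> \bar R :=
  fun A => \int[mu]_(x in A `&` D) (f x)%:E.

Local Notation nu := (density mD intf f0).

Let density0 : nu set0 = 0.
Proof. by rewrite /density set0I integral_set0. Qed.

Let density_ge0 A : 0 <= nu A.
Proof. by apply: integral_ge0 => x [_ Dx]; rewrite lee_fin f0. Qed.

Let density_sigma_additive : semi_sigma_additive nu.
Proof.
move=> F mF tF mUF; rewrite /density setI_bigcupl ge0_integral_bigcup//=.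
- by apply: is_cvg_ereal_nneg_natsum_cond => // n _ _; exact: density_ge0.
- by move=> k; exact: measurableI.
- rewrite -setI_bigcupl; apply: measurable_funS (measurable_int _ intf) => //.
- by move=> x [k _ [_ Dx]]; rewrite lee_fin f0.
- exact: trivIset_setIr.
Qed.

HB.instance Definition _ := isMeasure.Build _ _ _ nu
  density0 density_ge0 density_sigma_additive.

End density.

(* A |-> mu A / mu setT, for 0 < mu setT < +oo *)
Section normalized.
Context d (T : measurableType d) (R : realType).
Variable mu : {measure set T -> \bar R}.

Let inv_mass_ge0 : 0 <= (fine (mu setT))^-1.
Proof. by rewrite invr_ge0 fine_ge0. Qed.

Definition normalized : {measure set T -> \bar R} :=
  mscale (NngNum inv_mass_ge0) mu.

End normalized.

Section operators.
Context d (T : measurableType d) (R : realType).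
Implicit Types (nu : {measure set T -> \bar R}) (S : set T).
Implicit Types (Q : T -> {measure set T -> \bar R}).
Implicit Types (P : (T -> R) -> (T -> R)).

(* Only the trace of Q x on S, for x in S, is meaningful. *)
Definition markov_kernel_on S Q : Prop :=
  (forall x, S x -> Q x S = 1%E) /\
  (forall A, measurable A -> A `<=` S -> measurable_fun S (Q ^~ A)).

Definition reversible S nu Q : Prop :=
  forall A B, measurable A -> measurable B -> A `<=` S -> B `<=` S ->
    (\int[nu]_(x in A) Q x B = \int[nu]_(x in B) Q x A)%E.

Definition markov_operator S Q : (T -> R) -> (T -> R) :=
  fun f => (fun x => \int[Q x]_(y in S) f y) \_ S.

Definition inner nu (f g : T -> R) : R := \int[nu]_x (f x * g x).

(* P acts on representatives; the second clause makes it an operator on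
   a.e. classes. *)
Definition self_adjoint nu P : Prop :=
  [/\ {in Lfun nu 2%:E, forall f, P f \in Lfun nu 2%:E},
      {in Lfun nu 2%:E &, forall f g,
        f = g %[ae nu] -> P f = P g %[ae nu]},
      forall a : R, {in Lfun nu 2%:E &, forall f g,
        P (a \*o f \+ g) = a \*o P f \+ P g %[ae nu]} &
      {in Lfun nu 2%:E &, forall f g, inner nu (P f) g = inner nu f (P g)}].

(* For the Markov operator of a nu-reversible kernel, which is self-adjoint,
   this is positivity. *)
Definition nonneg_form nu P : Prop :=
  {in Lfun nu 2%:E, forall f, 0 <= inner nu (P f) f}.

Definition positive_operator nu P : Prop :=
  self_adjoint nu P /\ nonneg_form nu P.

End operators.

Section slice_sampler.
Context (R : realType) (d : nat).
Variables (K : set (d.-tuple R)) (rho : d.-tuple R -> R).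

Definition superlevel (t : R) : set (d.-tuple R) :=
  [set x | K x /\ t <= rho x].

Lemma measurable_superlevel t : measurable K ->
  (vol R d).-integrable K (EFin \o rho) -> measurable (superlevel t).
Proof.
move=> mK /measurable_int/measurable_EFinP mrho.
rewrite (_ : superlevel t = K `&` rho @^-1` `[t, +oo[); first exact: mrho.
by apply/seteqP; split=> x /=; rewrite in_itv/= andbT.
Qed.

Definition target (mK : measurable K)
    (irho : (vol R d).-integrable K (EFin \o rho))
    (rho0 : forall x, K x -> 0 <= rho x) :
    {measure set (d.-tuple R) -> \bar R} :=
  normalized (density mK irho rho0).

Definition level_uniform (mK : measurable K)
    (irho : (vol R d).-integrable K (EFin \o rho)) (t : R) :
    {measure set (d.-tuple R) -> \bar R} :=
  normalized (mrestr (vol R d) (measurable_superlevel t mK irho)).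

(* The levels t for which there is a kernel on K(t) *)
Definition level (t : R) : Prop := 0 < t /\ (0 < vol R d (superlevel t))%E.

Variable Q : R -> d.-tuple R -> {measure set (d.-tuple R) -> \bar R}.

(* The kernel at t, hence the inner integral, is given only for t such that
   [level t]; for almost every x in K these are almost all of ]0, rho x]. *)
Definition slice_sampler : (d.-tuple R -> R) -> (d.-tuple R -> R) :=
  fun f => (fun x => (rho x)^-1 *
    \int[lebesgue_measure]_(t in `]0, rho x] `&` level)
      \int[Q t x]_(y in superlevel t) f y) \_ K.

(* The formula defining [slice_sampler f x] makes sense: no integral in it takes
   the default value of a divergent integral. *)
Definition slice_sampler_defined (f : d.-tuple R -> R) (x : d.-tuple R) : Prop :=
  [/\ 0 < rho x,
      {ae lebesgue_measure, forall t, t \in `]0, rho x] ->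
        level t /\ (Q t x).-integrable (superlevel t) (EFin \o f)} &
      lebesgue_measure.-integrable (`]0, rho x] `&` level)
        (fun t => (\int[Q t x]_(y in superlevel t) f y)%:E)].

End slice_sampler.

(* Main.v *)
(** Put [r = rho] on [K] and [0] elsewhere, and for [z = (x, t)] with
    [0 < t <= rho x] and [vol K(t) > 0] let [k z] be the measure [R_t(x, .)] on
    [K(t)]; let [k z = 0] for every other [z].  Integrating the reversibility of
    the [R_t] over [t] shows that [\int f(x) (\int g dk z) dz] is symmetric in
    [f, g >= 0]; with [g = 1] this says that [z |-> \int f dk z] has integral
    [\int f r].  Hence, for [f] in L2(pi), [f] is square integrable for [k z] for
    almost all [z], and up to the factor [\int rho] the form [<Rf, g>] equals
    [\int g(x) (\int f dk z) dz].  This form is symmetric, and slicing it in [t]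
    leaves the nonnegative forms of the [R_t].  That [R] is bounded on L2(pi)
    follows by averaging [2 a f - a^2 <= f^2] with [a = Rf(x)]. *)

Require Import Defs.
From mathcomp Require Import all_boot all_order all_algebra.
From mathcomp Require Import all_classical all_reals all_analysis.
From mathcomp Require Import measurable_realfun.
From mathcomp Require Import lra.

Set Implicit Arguments.
Unset Strict Implicit.
Unset Printing Implicit Defensive.

Import Order.TTheory GRing.Theory Num.Theory.
Import numFieldNormedType.Exports.

Local Open Scope classical_set_scope.
Local Open Scope ring_scope.

(** The obstacle is integrability. This fixes the order: nonnegative functions with extended values
    first, where Tonelli and monotone limits need no finiteness; then integrability under [k z] for
    almost every [z]; only then signed functions, through positive and negative parts. The mass of
    [k z] is the indicator of a measurable set [D]. Its sections at [x] have length [r x] for almost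
    every [x], because the points under the graph at levels with vol K(t) = 0 form a null set by
    Tonelli. The abstract part of the proof speaks only of [D], [r] and [k], not of superlevel sets.
    In the quadratic inequality the number [a] is free. Taken constant in [t], it treats the mean
    under R_t and the mean over [t] in one integration, where Jensen would have to be applied
    twice. *)

Lemma ge0_nondecreasing_limeMl (R : realType) (c : \bar R) (u : (\bar R)^nat) :
  (0 <= c)%E -> (forall n, (0 <= u n)%E) -> nondecreasing_seq u ->
  limn (fun n => c * u n)%E = (c * limn u)%E.
Proof.
move=> c0 u0 ndu; have cu := ereal_nondecreasing_is_cvgn ndu.
have ub (v : (\bar R)^nat) n : nondecreasing_seq v -> (v n <= limn v)%E.
  move=> ndv; rewrite (cvg_lim _ (ereal_nondecreasing_cvgn ndv))//.
  by apply: ereal_sup_ubound; exists n.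
case: c c0 => [c _|_|//]; first by rewrite limeMl.
(* For the factor [+oo], either some term is positive and both sides are [+oo], or all terms vanish
   and both sides are zero since [+oo * 0 = 0]. *)
have ndcu : nondecreasing_seq (fun n => +oo * u n)%E.
  by move=> m n mn; rewrite lee_wpmul2l// ndu.
have [[n un0]|u0'] := pselect (exists n, u n != 0%E).
  have unp : (0 < u n)%E by rewrite lt0e un0 u0.
  have ulim : (0 < limn u)%E.
    by apply: lt_le_trans unp _; exact: ub.
  rewrite (gt0_mulye ulim); apply/eqP; rewrite -leye_eq.
  by apply: le_trans (ub _ n ndcu); rewrite /= (gt0_mulye unp).
have -> : u = cst 0%E.
  by apply/funext => n; apply/eqP/negPn/negP => un; apply: u0'; exists n.
under eq_fun do rewrite /= mule0.
by rewrite !lim_cst// mule0.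
Qed.

(** * Induction on nonnegative measurable functions *)

Section measurable_fun_induction.
Context d (T : measurableType d) (R : realType).
Variable P : (T -> \bar R) -> Prop.
Local Open Scope ereal_scope.
Import HBNNSimple.

Lemma ge0_measurable_fun_ind :
  (forall A, measurable A -> P (EFin \o \1_A)) ->
  (forall f g, measurable_fun setT f -> measurable_fun setT g ->
    (forall x, 0 <= f x) -> (forall x, 0 <= g x) ->
    P f -> P g -> P (f \+ g)) ->
  (forall (a : R) f, (0 <= a)%R -> measurable_fun setT f ->
    (forall x, 0 <= f x) -> P f -> P (fun x => a%:E * f x)) ->
  (forall f_ : (T -> \bar R)^nat, (forall n, measurable_fun setT (f_ n)) ->
    (forall n x, 0 <= f_ n x) -> (forall x, nondecreasing_seq (f_ ^~ x)) ->
    (forall n, P (f_ n)) -> P (fun x => limn (f_ ^~ x))) ->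
  forall f, measurable_fun setT f -> (forall x, 0 <= f x) -> P f.
Proof.
move=> P1 PD PZ Plim f mf f0.
have Psum (s : seq R) (A : R -> set T) : (forall y, measurable (A y)) ->
    (forall y, y \in s -> (0 <= y)%R) ->
    P (fun x => \sum_(y <- s) y%:E * (\1_(A y) x)%:E).
  move=> mA; elim: s => [|y s ih] s0.
    under eq_fun do rewrite big_nil.
    rewrite (_ : (fun=> _) = EFin \o \1_set0); first exact: (P1 _ measurable0).
    by apply/funext => x /=; rewrite indic0.
  under eq_fun do rewrite big_cons.
  have y0 : (0 <= y)%R by apply: s0; rewrite mem_head.
  have s0' z : z \in s -> (0 <= z)%R by move=> zs; apply: s0; rewrite inE zs orbT.
  apply: PD => //.
  - by apply: measurable_funeM; apply/measurable_EFinP.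
  - by apply: emeasurable_sum => z; apply: measurable_funeM; apply/measurable_EFinP.
  - by move=> x; rewrite mule_ge0// lee_fin.
  - move=> x; rewrite big_seq; apply: sume_ge0 => z zs.
    by rewrite mule_ge0// lee_fin ?s0'.
  - apply: (PZ y (EFin \o \1_(A y))) => //; first exact/measurable_EFinP.
      by move=> x; rewrite lee_fin.
    exact: (P1 _ (mA y)).
  - exact: ih.
pose f_ := nnsfun_approx measurableT mf.
rewrite (_ : f = fun x => limn (fun n => (f_ n x)%:E)); last first.
  by apply/funext => x; apply/esym/cvg_lim => //; exact: cvg_nnsfun_approx.
apply: Plim => [n|n x|x m n mn|n].
- by apply/measurable_EFinP.
- by rewrite lee_fin.
- by rewrite lee_fin; exact/lefP/nd_nnsfun_approx.
- rewrite (_ : (fun x => _) = fun x =>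
    \sum_(y <- finmap.enum_fset (fset_set (range (f_ n)))) y%:E *
      (\1_(f_ n @^-1` [set y]) x)%:E).
    apply: Psum => // y; rewrite in_fset_set//.
    by rewrite inE => -[x _ <-].
  by apply/funext => x; rewrite fimfunE fsbig_finite//= -sumEFin.
Qed.

End measurable_fun_induction.

(** * Integration against a measurable family of measures *)

Section kernel_integral.
Context d d' (X : measurableType d) (Y : measurableType d') (R : realType).
Variable k : X -> {measure set Y -> \bar R}.
Hypothesis mk : forall U, measurable U -> measurable_fun setT (k ^~ U).
Local Open Scope ereal_scope.

Lemma measurable_integral_kernel (f : Y -> \bar R) : measurable_fun setT f ->
  measurable_fun setT (fun x => \int[k x]_y f y).
Proof.
move=> mf; under eq_fun do rewrite integralE.
by apply: emeasurable_funB; apply: measurable_fun_integral_kernel => //;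
  [exact: measurable_funepos | exact: measurable_funeneg].
Qed.

Lemma measurable_Rintegral_kernel (f : Y -> R) : measurable_fun setT f ->
  measurable_fun setT (fun x => (\int[k x]_y f y)%R).
Proof.
move=> mf; rewrite /Rintegral.
apply: (@measurableT_comp _ _ _ _ _ _ (@fine R)) => //.
by apply: measurable_integral_kernel; exact/measurable_EFinP.
Qed.

Context (m : {measure set X -> \bar R}) (p : X -> Y).
Hypothesis mp : measurable_fun setT p.

Let kI (f : Y -> \bar R) x := \int[k x]_y f y.

Let kI_ge0 f x : (forall y, 0 <= f y) -> 0 <= kI f x.
Proof. by move=> f0; exact: integral_ge0. Qed.

(** Extension from indicators, one argument at a time: [step] passes from [h] against all indicators
    to [h] against all nonnegative functions. No finiteness is assumed; both sides may be
    infinite. *)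
Lemma kernel_form_sym :
  (forall A B, measurable A -> measurable B ->
    \int[m]_x ((\1_A (p x))%:E * k x B) = \int[m]_x ((\1_B (p x))%:E * k x A)) ->
  forall f g, measurable_fun setT f -> measurable_fun setT g ->
    (forall y, 0 <= f y) -> (forall y, 0 <= g y) ->
  \int[m]_x (f (p x) * \int[k x]_y g y) = \int[m]_x (g (p x) * \int[k x]_y f y).
Proof.
move=> sym f g mf mg f0 g0.
have mpf (h : Y -> \bar R) : measurable_fun setT h -> measurable_fun setT (h \o p).
  by move=> mh; exact: measurableT_comp.
have mfg (h h' : Y -> \bar R) : measurable_fun setT h -> measurable_fun setT h' ->
    measurable_fun setT (fun x => h (p x) * kI h' x).
  move=> mh mh'; apply: emeasurable_funM; first exact: mpf.
  exact: measurable_integral_kernel.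
have mulP h h' : (forall y, 0 <= h y) -> (forall y, 0 <= h' y) ->
    forall x, 0 <= h (p x) * kI h' x.
  by move=> h0 h'0 x; rewrite mule_ge0// kI_ge0.
have step (h : Y -> \bar R) : measurable_fun setT h -> (forall y, 0 <= h y) ->
    (forall A, measurable A ->
      \int[m]_x (h (p x) * kI (EFin \o \1_A) x) =
      \int[m]_x ((EFin \o \1_A) (p x) * kI h x)) ->
    forall g, measurable_fun setT g -> (forall x, 0 <= g x) ->
      \int[m]_x (h (p x) * kI g x) = \int[m]_x (g (p x) * kI h x).
  move=> mh h0; move=> h1.
  apply: (@ge0_measurable_fun_ind _ _ _ (fun g =>
    \int[m]_x (h (p x) * kI g x) = \int[m]_x (g (p x) * kI h x)) h1);
    clear h1 sym mf mg f0 g0 f g.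
  - move=> u v mu mv u0 v0 hu hv.
    rewrite (_ : (fun x => h (p x) * _) =
        (fun x => h (p x) * kI u x + h (p x) * kI v x)); last first.
      apply/funext => x; rewrite /kI ge0_integralD//.
      by rewrite ge0_muleDr// kI_ge0.
    rewrite ge0_integralD//; [|by move=> x _; exact: mulP|exact: mfg
                              |by move=> x _; exact: mulP|exact: mfg].
    rewrite hu hv -ge0_integralD//; [|by move=> x _; exact: mulP|exact: mfg
                                     |by move=> x _; exact: mulP|exact: mfg].
    by apply: eq_integral => x _; rewrite ge0_muleDl.
  - move=> a u a0 mu u0 hu.
    rewrite (_ : (fun x => h (p x) * _) = (fun x => a%:E * (h (p x) * kI u x)));
      last first.
      by apply/funext => x; rewrite /kI ge0_integralZl_EFin// muleCA.
    rewrite ge0_integralZl_EFin//; [|by move=> x _; exact: mulP|exact: mfg].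
    rewrite hu -ge0_integralZl_EFin//; [|by move=> x _; exact: mulP|exact: mfg].
    by apply: eq_integral => x _; rewrite muleA.
  - move=> u mu u0 ndu hu.
    have ndkI x : nondecreasing_seq (fun n => kI (u n) x).
      by move=> a b ab; apply: ge0_le_integral => // y _; exact: ndu.
    transitivity (limn (fun n => \int[m]_x (h (p x) * kI (u n) x))).
      rewrite -monotone_convergence//; last 3 first.
        + by move=> n; exact: mfg.
        + by move=> n x _; exact: mulP.
        + by move=> x _ a b ab; rewrite lee_wpmul2l// ndkI.
      apply: eq_integral => x _; rewrite /kI monotone_convergence//.
      by rewrite (ge0_nondecreasing_limeMl (h0 _)
        (fun n => kI_ge0 x (u0 n)) (ndkI x)).
    rewrite (_ : (fun n => _) =
      (fun n => \int[m]_x (u n (p x) * kI h x))); last exact/funext.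
    rewrite -monotone_convergence//; last 3 first.
      + by move=> n; exact: mfg.
      + by move=> n x _; exact: mulP.
      + by move=> x _ a b ab; rewrite lee_wpmul2r ?kI_ge0// ndu.
    apply: eq_integral => x _; rewrite muleC.
    rewrite -(ge0_nondecreasing_limeMl (kI_ge0 x h0) (fun n => u0 n _) (ndu _)).
    by congr (limn _); apply/funext => n; rewrite muleC.
have m1 A : measurable A -> measurable_fun setT (EFin \o \1_A : Y -> \bar R).
  by move=> mA; exact/measurable_EFinP.
have p1 A (y : Y) : 0 <= (EFin \o \1_A) y :> \bar R by rewrite lee_fin.
(* What [step] requires of [f] against indicators is, read backwards, the conclusion of [step] for
   an indicator, whose own premise is [sym]. *)
apply: (step f mf f0) => // A mA.
apply/esym; apply: (step _ (m1 _ mA) (p1 A)) => // B mB.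
under eq_integral do rewrite /kI/= integral_indic ?setIT//.
by rewrite sym//; apply: eq_integral => x _; rewrite /kI/= integral_indic// setIT.
Qed.

End kernel_integral.

Lemma measurable_neq_fun d (T : measurableType d) (R : realType) (f g : T -> R) :
  measurable_fun setT f -> measurable_fun setT g ->
  measurable [set x | f x != g x].
Proof.
move=> mf mg.
rewrite (_ : mkset _ = ~` (fun x => f x - g x) @^-1` [set 0]).
  apply: measurableC; rewrite -[X in measurable X]setTI.
  by apply: measurable_funB.
apply/seteqP; split=> x /=.
  by move=> /eqP fg /eqP; rewrite subr_eq0 => /eqP.
by move=> fg; apply/eqP => fgx; apply: fg; rewrite fgx subrr.
Qed.

(** * Almost everywhere statements on products *)

Section almost_everywhere_lemmas.
Context d1 d2 (T : measurableType d1) (S : measurableType d2) (R : realType).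
Local Open Scope ereal_scope.

(** The measure of a null set is the integral of the measures of its sections, so almost all
    sections are null. *)
Lemma ae_product_measure1 (mu : {sigma_finite_measure set T -> \bar R})
    (lam : {sigma_finite_measure set S -> \bar R}) (P : T * S -> Prop) :
  {ae mu \x lam, forall z, P z} ->
  {ae mu, forall x, {ae lam, forall s, P (x, s)}}.
Proof.
move=> [N [mN N0 PN]].
have : ae_eq mu setT (fun x => lam (xsection N x)) (cst 0).
  apply/ae_eq_integral_abs => //; first exact: measurable_fun_xsection.
  by rewrite -[RHS]N0; apply: eq_integral => x _; rewrite gee0_abs.
apply: filterS => x /(_ I) Nx0.
exists (xsection N x); split => //; first exact: measurable_xsection.
by move=> s /= nP; rewrite /xsection/= inE; exact: PN.
Qed.

Lemma ge0_ae_lty (mu : {measure set T -> \bar R}) (f : T -> \bar R) :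
  measurable_fun setT f -> (forall x, 0 <= f x) ->
  \int[mu]_x f x < +oo -> {ae mu, forall x, f x < +oo}.
Proof.
move=> mf f0 foo.
have /integrable_ae : mu.-integrable setT f.
  apply/integrableP; split => //.
  by under eq_integral do rewrite gee0_abs//.
by move=> /(_ measurableT); apply: filterS => x /(_ I); rewrite ge0_fin_numE.
Qed.

End almost_everywhere_lemmas.

(** * Square integrable functions for a finite measure *)

Section square_integrable_kernel.
Context d (T : measurableType d) (R : realType).
Variables (m : {measure set T -> \bar R}) (c : R).
Hypothesis mc : m setT = c%:E.

Let mfin (a : R) : m.-integrable setT (EFin \o cst a).
Proof.
apply: measurable_bounded_integrable => //; first by rewrite mc ltry.
exact: bounded_cst.
Qed.

Variable f : T -> R.
Hypothesis mf : measurable_fun setT f.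
Hypothesis foo : (\int[m]_x (f x ^+ 2)%:E < +oo)%E.

Lemma integrable_sqr_finite : m.-integrable setT (EFin \o (fun x => f x ^+ 2)).
Proof.
apply/integrableP; split; first by apply/measurable_EFinP; exact: measurable_funX.
by under eq_integral do rewrite /= ger0_norm ?sqr_ge0//.
Qed.

Lemma integrable_of_sqr_finite : m.-integrable setT (EFin \o f).
Proof.
(* The dominating function is [1 + f ^+ 2], integrable because the mass is finite. *)
apply: (le_integrable measurableT) (integrableD measurableT
  (mfin 1) integrable_sqr_finite).
  exact/measurable_EFinP.
move=> x _ /=; rewrite lee_fin [leRHS]ger0_norm ?addr_ge0 ?sqr_ge0//.
by rewrite ler_norml; apply/andP; split; nra.
Qed.

(** Integrate [(f - a) ^+ 2 >= 0]. For mass one and [a] the mean of [f] this is Jensen's inequality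
    for the square. *)
Lemma Rintegral_sqr_ge (a : R) :
  2 * a * \int[m]_x f x - a ^+ 2 * c <= \int[m]_x (f x ^+ 2).
Proof.
have ifa := integrable_of_sqr_finite; have if2 := integrable_sqr_finite.
rewrite -subr_ge0.
rewrite (_ : _ - _ = \int[m]_x ((f x ^+ 2 - 2 * a * f x) + a ^+ 2)); last first.
  rewrite RintegralD//; last 2 first.
  - by have := integrableB measurableT if2 (integrableZl measurableT (2 * a) ifa).
  - exact: (mfin (a ^+ 2)).
  rewrite RintegralB//; last first.
    by have := integrableZl measurableT (2 * a) ifa.
  rewrite RintegralZl// Rintegral_cst// mc/=; lra.
by apply: Rintegral_ge0 => x _; have := sqr_ge0 (f x - a); nra.
Qed.

End square_integrable_kernel.

(** * Abstract reversible families over a product space *)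

Section reversible_family.
Context d1 d2 (T : measurableType d1) (S : measurableType d2) (R : realType).
Variables (mu : {sigma_finite_measure set T -> \bar R})
  (lam : {sigma_finite_measure set S -> \bar R}).
Variable k : T * S -> {measure set T -> \bar R}.
Hypothesis mk : forall U, measurable U -> measurable_fun setT (k ^~ U).
Variable D : set (T * S).
Hypothesis mD : measurable D.
Hypothesis kT : forall z, k z setT = (\1_D z)%:E.
Hypothesis k_sym : forall A B, measurable A -> measurable B ->
  (\int[mu \x lam]_z ((\1_A z.1)%:E * k z B) =
   \int[mu \x lam]_z ((\1_B z.1)%:E * k z A))%E.
Variable r : T -> R.
Hypotheses (mr : measurable_fun setT r) (r0 : forall x, 0 <= r x).
Hypothesis ir : mu.-integrable setT (EFin \o r).
Hypothesis rD :
  {ae mu, forall x, \int[lam]_s (\1_D (x, s))%:E = (r x)%:E}%E.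

Let m := (mu \x lam)%E.

Definition weighted_L2 (f : T -> R) : Prop :=
  measurable_fun setT f /\ (\int[mu]_x (f x ^+ 2 * r x)%:E < +oo)%E.

Definition kmean (f : T -> R) (z : T * S) : R := \int[k z]_y f y.

Definition kmean_section (f : T -> R) (x : T) : R := \int[lam]_s kmean f (x, s).

(** The abstract slice sampler. It vanishes where [r x = 0], by the convention that the inverse of
    zero is zero. *)
Definition averaged (f : T -> R) (x : T) : R := (r x)^-1 * kmean_section f x.

Let kmean2 (f : T -> R) z : \bar R := (\int[k z]_y (f y ^+ 2)%:E)%E.

Let m1D : measurable_fun setT (EFin \o \1_D : T * S -> \bar R).
Proof. exact/measurable_EFinP. Qed.

Let mfst (g : T -> \bar R) : measurable_fun setT g ->
  measurable_fun setT (fun z : T * S => g z.1).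
Proof. by move=> mg; apply: (measurableT_comp mg); exact: measurable_fst. Qed.

Let mkmean f : measurable_fun setT f -> measurable_fun setT (kmean f).
Proof. exact: measurable_Rintegral_kernel. Qed.

Let msqr (f : T -> R) : measurable_fun setT f ->
  measurable_fun setT (fun x => (f x ^+ 2)%:E).
Proof. by move=> mf; apply/measurable_EFinP; exact: measurable_funX. Qed.

Let mkmean2 f : measurable_fun setT f -> measurable_fun setT (kmean2 f).
Proof. by move=> mf; apply: measurable_integral_kernel => //; exact: msqr. Qed.

Let kmean2_ge0 f z : (0 <= kmean2 f z)%E.
Proof. by apply: integral_ge0 => y _; rewrite lee_fin sqr_ge0. Qed.

Let k_null z : ~ D z -> forall f, (\int[k z]_y f y = 0)%E.
Proof.
move=> nDz f; have k0 : k z setT = 0%E.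
  by rewrite kT indicE memNset.
rewrite (eq_measure_integral mzero); first exact: integral_measure_zero.
move=> A mA _; rewrite /mzero; apply/eqP; rewrite -measure_le0 -[leRHS]k0.
by apply: le_measure; rewrite ?inE.
Qed.

Let kmean_null z f : ~ D z -> kmean f z = 0.
Proof. by move=> nDz; rewrite /kmean /Rintegral k_null. Qed.

(** Integrate over [s] first: the section of [D] at [x] has length [r x]. So [m] restricted to [D]
    has first marginal [r] times [mu]. *)
Lemma integral_domain (g : T -> \bar R) : measurable_fun setT g ->
  (forall x, 0 <= g x)%E ->
  (\int[m]_z (g z.1 * (\1_D z)%:E) = \int[mu]_x (g x * (r x)%:E))%E.
Proof.
move=> mg g0; rewrite fubini_tonelli1/=; last 2 first.
  by apply: emeasurable_funM => //; exact: mfst.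
  by move=> z; rewrite mule_ge0// lee_fin.
have m1Dx x : measurable_fun setT (fun s => (\1_D (x, s))%:E : \bar R).
  by apply/measurable_EFinP; apply: measurableT_comp.
have E x : (\int[lam]_s (g x * (\1_D (x, s))%:E) =
    g x * \int[lam]_s (\1_D (x, s))%:E)%E.
  by rewrite ge0_integralZl// => s _; rewrite lee_fin.
rewrite /fubini_F; under eq_integral do rewrite /= E.
apply: ge0_ae_eq_integral => //.
- apply: emeasurable_funM => //.
  apply: (measurable_fun_fubini_tonelli_F (EFin \o \1_D : T * S -> \bar R)) => //.
  by move=> z; rewrite lee_fin.
- by apply: emeasurable_funM => //; exact/measurable_EFinP.
- by move=> x _; rewrite mule_ge0// integral_ge0// => s _; rewrite lee_fin.
- by move=> x _; rewrite mule_ge0// lee_fin.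
- by apply: filterS rD => x ->.
Qed.

Lemma integral_kernel (g : T -> \bar R) : measurable_fun setT g ->
  (forall x, 0 <= g x)%E ->
  (\int[m]_z \int[k z]_y g y = \int[mu]_x (g x * (r x)%:E))%E.
Proof.
move=> mg g0; rewrite -integral_domain//.
have mfst1 : measurable_fun setT (fst : T * S -> T) by exact: measurable_fst.
have := kernel_form_sym mk (m := m) mfst1 k_sym
  (measurable_cst (1%E : \bar R)) mg (fun=> lee01) g0.
under eq_integral do rewrite mul1e.
move=> ->; apply: eq_integral => z _.
by rewrite integral_cst// mul1e -kT.
Qed.

Lemma kmean2_lty f : weighted_L2 f -> (\int[m]_z kmean2 f z < +oo)%E.
Proof.
move=> [mf foo]; rewrite integral_kernel//; first exact: msqr.
by move=> x; rewrite lee_fin sqr_ge0.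
Qed.

Lemma ae_kmean2_lty f : weighted_L2 f -> {ae m, forall z, kmean2 f z < +oo}%E.
Proof.
move=> Lf; apply: ge0_ae_lty; last exact: kmean2_lty.
- by apply: mkmean2; case: Lf.
- exact: kmean2_ge0.
Qed.

Lemma ae_integrable_kernel f : weighted_L2 f ->
  {ae m, forall z, (k z).-integrable setT (EFin \o f)}.
Proof.
move=> Lf; apply: filterS (ae_kmean2_lty Lf) => z.
by apply: (integrable_of_sqr_finite (kT z)); case: Lf.
Qed.

(** This is [Rintegral_sqr_ge] for [k z], of mass [\1_D z]. If [kmean2 f z] is infinite, the right
    side is [+oo] and the default value of [kmean] does no harm. *)
Lemma kmean_ge f z (a : R) : measurable_fun setT f ->
  ((2 * a * kmean f z)%:E <= kmean2 f z + (a ^+ 2 * \1_D z)%:E)%E.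
Proof.
move=> mf; have [->|foo] := eqVneq (kmean2 f z) +oo%E; first exact: leey.
have flt : (kmean2 f z < +oo)%E by rewrite ltey.
have kfin : kmean2 f z \is a fin_num by rewrite ge0_fin_numE.
have := Rintegral_sqr_ge (kT z) mf flt a.
by rewrite -(fineK kfin) -EFinD lee_fin lerBlDr.
Qed.

(** Jensen, from the best choice of [a] in [kmean_ge], the mean itself; off [D] the mean is zero. *)
Lemma kmean_sqr_le f z : measurable_fun setT f ->
  (((kmean f z) ^+ 2)%:E <= kmean2 f z)%E.
Proof.
move=> mf; have := kmean_ge z (kmean f z) mf.
rewrite -leeBlDr// -EFinB; apply: le_trans; rewrite lee_fin.
have [Dz|Dz] := pselect (D z); first by rewrite indicE mem_set//=; lra.
by rewrite kmean_null// mulr0 expr0n/= mul0r subr0.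
Qed.

Lemma integrable_kmean_mul f g : weighted_L2 f -> weighted_L2 g ->
  m.-integrable setT (fun z => (g z.1 * kmean f z)%:E).
Proof.
move=> Lf Lg; have [mf _] := Lf; have [mg goo] := Lg.
have i1 : m.-integrable setT (kmean2 f).
  apply/integrableP; split; first exact: mkmean2.
  by under eq_integral do rewrite gee0_abs//; exact: kmean2_lty.
have i2 : m.-integrable setT (fun z => (g z.1 ^+ 2)%:E * (\1_D z)%:E)%E.
  apply/integrableP; split.
    by apply: emeasurable_funM => //; apply: (mfst (msqr mg)).
  under eq_integral do rewrite gee0_abs ?mule_ge0 ?lee_fin ?sqr_ge0//.
  rewrite (integral_domain (msqr mg))// => x; by rewrite lee_fin sqr_ge0.
(* The product is dominated by [g ^+ 2] on [D] plus [kmean2 f]. The indicator of [D] is essential: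
   it limits the integral over [s] to the length [r x]. *)
apply: (le_integrable measurableT) (integrableD measurableT i2 i1).
  apply/measurable_EFinP; apply: measurable_funM; last exact: mkmean.
  by apply: (measurableT_comp mg); exact: measurable_fst.
move=> z _; rewrite [leRHS]gee0_abs; last first.
  by rewrite adde_ge0// mule_ge0// lee_fin sqr_ge0.
apply: (@le_trans _ _ ((g z.1 ^+ 2)%:E * (\1_D z)%:E + (kmean f z ^+ 2)%:E)%E);
  last by rewrite leeD2l// kmean_sqr_le.
rewrite -EFinM -EFinD lee_fin.
have [Dz|Dz] := pselect (D z); last by
  rewrite kmean_null// mulr0 normr0 expr0n/= addr0 mulr_ge0// sqr_ge0.
rewrite indicE mem_set//= mulr1 ler_norml.
by have := sqr_ge0 (g z.1 + kmean f z); have := sqr_ge0 (g z.1 - kmean f z);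
   move=> *; apply/andP; split; nra.
Qed.

(** With [g = 1], [integrable_kmean_mul] makes [kmean f] itself integrable over the product. *)
Lemma weighted_L2_cst1 : weighted_L2 (cst 1).
Proof.
split => //; under eq_integral do rewrite /= expr1n mul1r -[r _]ger0_norm//.
by have /integrableP[] := ir.
Qed.

Lemma ae_integrable_section f : weighted_L2 f ->
  {ae mu, forall x, lam.-integrable setT (fun s => (kmean f (x, s))%:E)}.
Proof.
move=> Lf; apply: filterS (ae_integrable1 (integrable_kmean_mul Lf weighted_L2_cst1)).
by move=> x; apply: eq_integrable => // s _; rewrite /= mul1r.
Qed.

(** Tonelli with [s] outermost. This is what allows the positivity hypothesis of a single level to
    be applied to [f]. *)
Lemma ae_section_L2 f : weighted_L2 f ->
  {ae lam, forall s, \int[mu]_x ((f x ^+ 2)%:E * (\1_D (x, s))%:E) < +oo}%E.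
Proof.
move=> [mf foo]; have mg : measurable_fun setT
    (fun z : T * S => (f z.1 ^+ 2)%:E * (\1_D z)%:E)%E.
  by apply: emeasurable_funM => //; apply: (mfst (msqr mf)).
have g0 z : (0 <= (f z.1 ^+ 2)%:E * (\1_D z)%:E)%E.
  by rewrite mule_ge0// lee_fin sqr_ge0.
apply: (@ge0_ae_lty _ _ _ lam (fubini_G mu (fun z : T * S =>
    (f z.1 ^+ 2)%:E * (\1_D z)%:E)%E)).
- by apply: measurable_fun_fubini_tonelli_G => //.
- by move=> s; apply: integral_ge0.
- rewrite -(fubini_tonelli2 _ mg g0) (integral_domain (msqr mf))// => x.
  by rewrite lee_fin sqr_ge0.
Qed.

(** * The averaged operator maps weighted L2 to itself *)

Lemma measurable_kmean_section f : weighted_L2 f ->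
  measurable_fun setT (kmean_section f).
Proof.
move=> Lf; apply: (@measurableT_comp _ _ _ _ _ _ (@fine R)) => //.
have := measurable_fubini_F (integrable_kmean_mul Lf weighted_L2_cst1).
rewrite /fubini_F; under eq_fun do under eq_integral do rewrite /= mul1r.
exact.
Qed.

Let measurable_averaged f : weighted_L2 f -> measurable_fun setT (averaged f).
Proof.
move=> Lf; apply: measurable_funM; last exact: measurable_kmean_section.
(* As [r] is nonnegative, its inverse is the power with exponent [-1], also at zero, and powers are
   measurable. *)
under eq_fun do rewrite -powR_inv1//.
by apply: (@measurableT_comp _ _ _ _ _ _ (@powR R ^~ (-1))).
Qed.

(** Dividing by [r x] loses nothing: if [r x = 0], the section of [D] at [x] is null, hence
    [kmean f (x, s)] vanishes for almost every [s]. *)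
Lemma ae_averaged_mul f : weighted_L2 f ->
  {ae mu, forall x, averaged f x * r x = kmean_section f x}.
Proof.
move=> [mf foo]; apply: filterS rD => x rx; rewrite /averaged.
have [rx0|rx0] := eqVneq (r x) 0; last by rewrite mulrAC mulVf// mul1r.
rewrite rx0 mulr0 /kmean_section /Rintegral.
have mks : measurable_fun setT (fun s => (kmean f (x, s))%:E).
  apply/measurable_EFinP.
  exact: (measurableT_comp (mkmean mf) (pair1_measurable x)).
rewrite (@ae_eq_integral _ _ _ lam setT (cst 0%E)) ?integral0//.
have : ae_eq lam setT (fun s => (\1_D (x, s))%:E : \bar R) (cst 0%E).
  apply/ae_eq_integral_abs => //.
    by apply/measurable_EFinP; apply: measurableT_comp.
  by under eq_integral do rewrite gee0_abs ?lee_fin//; rewrite rx rx0.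
apply: filterS => s /(_ I) /= Dxs _; rewrite kmean_null// => Dxs'.
by move: Dxs; rewrite indicE mem_set// => -[] /eqP; rewrite oner_eq0.
Qed.

(* [kmean_ge] with the constant [a := averaged f x], integrated over [s] *)
Lemma ae_averaged_sqr_le f : weighted_L2 f ->
  {ae mu, forall x, (averaged f x ^+ 2 * r x)%:E <=
                    \int[lam]_s kmean2 f (x, s)}%E.
Proof.
move=> Lf; have [mf foo] := Lf.
apply: filterS3 rD (ae_integrable_section Lf) (ae_averaged_mul Lf).
move=> x rx ikf ax; set a := averaged f x.
have [->|kfoo] := eqVneq (\int[lam]_s kmean2 f (x, s))%E +oo%E; first exact: leey.
have mk2 : measurable_fun setT (fun s => kmean2 f (x, s)).
  exact: (measurableT_comp (mkmean2 mf) (pair1_measurable x)).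
have ik2 : lam.-integrable setT (fun s => kmean2 f (x, s)).
  by apply/integrableP; split => //; under eq_integral do rewrite gee0_abs//;
    rewrite ltey.
have m1Dx : measurable_fun setT (fun s => (\1_D (x, s))%:E : \bar R).
  by apply/measurable_EFinP; apply: measurableT_comp.
have iD : lam.-integrable setT (fun s => (\1_D (x, s))%:E).
  apply/integrableP; split => //.
  by under eq_integral do rewrite gee0_abs ?lee_fin//; rewrite rx ltry.
have iD2 := integrableZl measurableT (a ^+ 2) iD.
have ikf2 := integrableZl measurableT (2 * a) ikf.
have := le_integral measurableT ikf2 (integrableD measurableT ik2 iD2).
rewrite (integralZl measurableT ikf) (integralD measurableT ik2 iD2).
rewrite (integralZl measurableT iD) rx.
have -> : (\int[lam]_s (kmean f (x, s))%:E)%E = (a * r x)%:E.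
  by rewrite ax /kmean_section /Rintegral fineK//; exact: integrable_fin_num.
(* The integrated inequality has [2 * a * (a * r x)] on the left and [a ^+ 2 * r x] on the right;
   their difference is the claimed bound. *)
rewrite -!EFinM -leeBlDr// -EFinB => H; apply: (le_trans _ (H _)).
  by rewrite lee_fin; nra.
by move=> s _; exact: kmean_ge.
Qed.

(** Integrated over [x], [ae_averaged_sqr_le] bounds the weighted square norm by the integral of
    [kmean2 f], which by [integral_kernel] is that of [f]. *)
Lemma weighted_L2_averaged f : weighted_L2 f -> weighted_L2 (averaged f).
Proof.
move=> Lf; have [mf foo] := Lf; split; first exact: measurable_averaged.
apply: le_lt_trans (kmean2_lty Lf).
have mk2 := mkmean2 mf.
rewrite fubini_tonelli1//; apply: ae_ge0_le_integral => //.
- by move=> x _; rewrite lee_fin mulr_ge0// sqr_ge0.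
- apply/measurable_EFinP; apply: measurable_funM => //.
  by apply: measurable_funX; exact: measurable_averaged.
- by move=> x _; apply: integral_ge0 => s _; exact: kmean2_ge0.
- by apply: measurable_fun_fubini_tonelli_F => // z; exact: kmean2_ge0.
- by apply: filterS (ae_averaged_sqr_le Lf).
Qed.

(** * The bilinear form: symmetry, linearity, positivity *)

Definition kmean_form (f g : T -> R) : R := \int[m]_z (g z.1 * kmean f z).

Lemma averaged_form f g : weighted_L2 f -> weighted_L2 g ->
  \int[mu]_x (averaged f x * g x * r x) = kmean_form f g.
Proof.
move=> Lf Lg; have i := integrable_kmean_mul Lf Lg.
rewrite /kmean_form /Rintegral -(integral12_prod_meas1 i); congr fine.
apply: ae_eq_integral => //.
- apply/measurable_EFinP; apply: measurable_funM => //; apply: measurable_funM.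
    exact: measurable_averaged.
  by case: Lg.
- exact: (measurable_fubini_F i).
apply: filterS2 (ae_averaged_mul Lf) (ae_integrable_section Lf) => x ax ikf _.
rewrite /fubini_F/= mulrAC ax mulrC EFinM.
under [RHS]eq_integral do rewrite EFinM.
rewrite integralZl// /kmean_section /Rintegral fineK//.
exact: integrable_fin_num.
Qed.

(** Apply [integral_kernel] to the indicator of [N]: almost every [k z] gives [N] measure zero, so
    the two means agree at such [z]. Square integrability is not involved, because functions equal
    almost everywhere also share default values. *)
Lemma ae_averaged_eq f g : measurable_fun setT f -> measurable_fun setT g ->
  (\int[mu]_x ((\1_[set x | f x != g x] x)%:E * (r x)%:E) = 0)%E ->
  {ae mu, forall x, averaged f x = averaged g x}.
Proof.
move=> mf mg N0; set N := [set x | f x != g x] in N0.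
have mN : measurable N by exact: measurable_neq_fun.
have m1N : measurable_fun setT (EFin \o \1_N : T -> \bar R).
  exact/measurable_EFinP.
have k0 : (\int[m]_z \int[k z]_y (EFin \o \1_N) y = 0)%E.
  by rewrite integral_kernel// => x; rewrite lee_fin.
have mkN : measurable_fun setT (fun z => \int[k z]_y (EFin \o \1_N) y)%E.
  exact: measurable_integral_kernel.
have : ae_eq m setT (fun z => \int[k z]_y (EFin \o \1_N) y)%E (cst 0%E).
  apply/ae_eq_integral_abs => //; rewrite -[RHS]k0.
  by apply: eq_integral => z _; rewrite gee0_abs// integral_ge0// => y _;
    rewrite lee_fin.
move=> /ae_product_measure1; apply: filterS => x kx.
rewrite /averaged /kmean_section; congr (_ * fine _).
have mks h : measurable_fun setT h ->
    measurable_fun setT (fun s => (kmean h (x, s))%:E).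
  move=> mh; apply/measurable_EFinP.
  exact: (measurableT_comp (mkmean mh) (pair1_measurable x)).
apply: ae_eq_integral; [exact: measurableT|exact: mks|exact: mks|].
apply: filterS kx => s /(_ I); rewrite integral_indic// setIT => kN _.
congr EFin; rewrite /kmean /Rintegral; congr fine.
apply: ae_eq_integral => //; [exact/measurable_EFinP|exact/measurable_EFinP|].
by exists N; split => // y /= /not_implyP[_] /eqP; apply: contra_neq => ->.
Qed.

Lemma weighted_L2_le (f g : T -> R) : measurable_fun setT f ->
  (forall x, `|f x| <= `|g x|) -> weighted_L2 g -> weighted_L2 f.
Proof.
move=> mf fg [mg goo]; split => //; apply: le_lt_trans goo.
have mw (h : T -> R) : measurable_fun setT h ->
    measurable_fun setT (fun x => (h x ^+ 2 * r x)%:E).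
  by move=> mh; apply/measurable_EFinP; apply: measurable_funM => //;
    exact: measurable_funX.
apply: ge0_le_integral => //; [|exact: mw|exact: mw|].
- by move=> x _; rewrite lee_fin mulr_ge0// sqr_ge0.
- move=> x _; rewrite lee_fin ler_wpM2r// -[f x ^+ 2]real_normK ?num_real//.
  by rewrite -[g x ^+ 2]real_normK ?num_real// lerXn2r// ?nnegrE.
Qed.

(** In this argument linearity holds only at those [z] where both functions are integrable for
    [k z]; in the other argument it is pointwise. *)
Lemma kmean_formBl f1 f2 g : weighted_L2 f1 -> weighted_L2 f2 -> weighted_L2 g ->
  kmean_form (f1 \- f2) g = kmean_form f1 g - kmean_form f2 g.
Proof.
move=> L1 L2 Lg; rewrite /kmean_form -RintegralB//; last 2 first.
- exact: integrable_kmean_mul.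
- exact: integrable_kmean_mul.
have [m1 _] := L1; have [m2 _] := L2; have [mg _] := Lg.
have mgk h : measurable_fun setT h ->
    measurable_fun setT (fun z : T * S => g z.1 * kmean h z).
  move=> mh; apply: measurable_funM; last exact: mkmean.
  by apply: (measurableT_comp mg); exact: measurable_fst.
congr fine; apply: ae_eq_integral => //.
- by apply/measurable_EFinP; apply: mgk; exact: measurable_funB.
- by apply/measurable_EFinP; apply: measurable_funB; exact: mgk.
apply: filterS2 (ae_integrable_kernel L1) (ae_integrable_kernel L2) => z i1 i2 _.
by rewrite -mulrBr /kmean RintegralB.
Qed.

Lemma kmean_formBr f g1 g2 : weighted_L2 f -> weighted_L2 g1 -> weighted_L2 g2 ->
  kmean_form f (g1 \- g2) = kmean_form f g1 - kmean_form f g2.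
Proof.
move=> Lf L1 L2; rewrite /kmean_form -RintegralB//; last 2 first.
- exact: integrable_kmean_mul.
- exact: integrable_kmean_mul.
by apply: eq_Rintegral => z _; rewrite -mulrBl.
Qed.

Let kmean_form_sym_ge0 f g : weighted_L2 f -> weighted_L2 g ->
  (forall x, 0 <= f x) -> (forall x, 0 <= g x) ->
  kmean_form f g = kmean_form g f.
Proof.
move=> Lf Lg f0 g0.
(* The real mean is the extended integral wherever [u] is integrable for [k z], so the form can be
   read as the one in [kernel_form_sym]. *)
have E u v : weighted_L2 u -> weighted_L2 v -> kmean_form u v =
    fine (\int[m]_z ((EFin \o v) z.1 * \int[k z]_y (EFin \o u) y))%E.
  move=> Lu Lv; have [mu' _] := Lu; have [mv _] := Lv; congr fine.
  apply: ae_eq_integral => //.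
  - by have /measurable_int := integrable_kmean_mul Lu Lv.
  - apply: emeasurable_funM; first by apply: mfst; exact/measurable_EFinP.
    by apply: measurable_integral_kernel => //; exact/measurable_EFinP.
  apply: filterS (ae_integrable_kernel Lu) => z iu _.
  by rewrite EFinM /kmean /Rintegral fineK//; exact: integrable_fin_num.
have [mf _] := Lf; have [mg _] := Lg.
have mfst1 : measurable_fun setT (fst : T * S -> T) by exact: measurable_fst.
rewrite (E _ _ Lf Lg) (E _ _ Lg Lf); congr fine; apply:
  (kernel_form_sym mk mfst1 k_sym) => //.
- exact/measurable_EFinP.
- exact/measurable_EFinP.
Qed.

(** Both arguments are split into positive and negative parts, which leaves four symmetric terms
    with nonnegative arguments. *)
Lemma kmean_formC f g : weighted_L2 f -> weighted_L2 g ->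
  kmean_form f g = kmean_form g f.
Proof.
have Lpos h : weighted_L2 h -> weighted_L2 h^\+.
  move=> Lh; apply: weighted_L2_le (Lh).
    by apply: measurable_funrpos; case: Lh.
  move=> x; rewrite ger0_norm ?funrpos_ge0// /funrpos ge_max ler_norm//=.
have Lneg h : weighted_L2 h -> weighted_L2 h^\-.
  move=> Lh; apply: weighted_L2_le (Lh).
    by apply: measurable_funrneg; case: Lh.
  by move=> x; rewrite ger0_norm ?funrneg_ge0// /funrneg ge_max -normrN ler_norm/=.
have dec (h : T -> R) : h = h^\+ \- h^\-.
  by apply/funext => x; rewrite /funrpos /funrneg/=; case: (leP (h x) 0) => h0;
    [rewrite (max_l (_ : 0 <= - h x)) ?oppr_ge0// sub0r opprK|
     rewrite max_r ?subr0// oppr_le0 ltW].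
move=> Lf Lg; have [Lfp Lfn Lgp Lgn] :=
  And4 (Lpos _ Lf) (Lneg _ Lf) (Lpos _ Lg) (Lneg _ Lg).
have sym u v := @kmean_form_sym_ge0 u v.
have Bl g' : weighted_L2 g' ->
    kmean_form f g' = kmean_form f^\+ g' - kmean_form f^\- g'.
  by move=> Lg'; rewrite {1}(dec f) kmean_formBl.
have Bl' f' : weighted_L2 f' ->
    kmean_form g f' = kmean_form g^\+ f' - kmean_form g^\- f'.
  by move=> Lf'; rewrite {1}(dec g) kmean_formBl.
have Br g' : weighted_L2 g' ->
    kmean_form g' g = kmean_form g' g^\+ - kmean_form g' g^\-.
  by move=> Lg'; rewrite {1}(dec g) kmean_formBr.
have Br' f' : weighted_L2 f' ->
    kmean_form f' f = kmean_form f' f^\+ - kmean_form f' f^\-.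
  by move=> Lf'; rewrite {1}(dec f) kmean_formBr.
rewrite (Bl _ Lg) (Br _ Lfp) (Br _ Lfn) (Bl' _ Lf) (Br' _ Lgp) (Br' _ Lgn).
rewrite (sym _ _ Lfp Lgp (funrpos_ge0 _) (funrpos_ge0 _)).
rewrite (sym _ _ Lfp Lgn (funrpos_ge0 _) (funrneg_ge0 _)).
rewrite (sym _ _ Lfn Lgp (funrneg_ge0 _) (funrpos_ge0 _)).
rewrite (sym _ _ Lfn Lgn (funrneg_ge0 _) (funrneg_ge0 _)).
move: (kmean_form g^\+ f^\+) (kmean_form g^\+ f^\-)
  (kmean_form g^\- f^\+) (kmean_form g^\- f^\-) => u1 u2 u3 u4.
lra.
Qed.

(** Additivity is used twice, each time under its own integrability: under [k z] for almost every
    [z], then along [s] for almost every [x]. *)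
Lemma ae_averaged_linear (a : R) f g : weighted_L2 f -> weighted_L2 g ->
  {ae mu, forall x, averaged (a \*o f \+ g) x = a * averaged f x + averaged g x}.
Proof.
move=> Lf Lg; have [mf _] := Lf; have [mg _] := Lg.
have mafg : measurable_fun setT (a \*o f \+ g).
  by apply: measurable_funD => //; exact: measurable_funM.
have : {ae m, forall z, kmean (a \*o f \+ g) z = a * kmean f z + kmean g z}.
  apply: filterS2 (ae_integrable_kernel Lf) (ae_integrable_kernel Lg) => z i1 i2.
  rewrite /kmean -RintegralZl// -RintegralD//.
  by have := integrableZl measurableT a i1.
move=> /ae_product_measure1 H.
apply: filterS3 H (ae_integrable_section Lf) (ae_integrable_section Lg).
move=> x kx i1 i2; have i1' := integrableZl measurableT a i1.
rewrite /averaged [a * (_ * _)]mulrCA -mulrDr; congr (_ * _).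
rewrite /kmean_section -RintegralZl// -RintegralD//.
have mks h : measurable_fun setT h -> measurable_fun setT (fun s => kmean h (x, s)).
  by move=> mh; exact: (measurableT_comp (mkmean mh) (pair1_measurable x)).
congr fine; apply: ae_eq_integral => //.
- by apply/measurable_EFinP; apply: mks.
- apply/measurable_EFinP; apply: measurable_funD; last exact: mks.
  by apply: measurable_funM => //; exact: mks.
- by apply: filterS kx => s ->.
Qed.

Lemma kmean_form_ge0 f : weighted_L2 f ->
  {ae lam, forall s, 0 <= \int[mu]_x (f x * kmean f (x, s))} ->
  0 <= kmean_form f f.
Proof.
move=> Lf f0; have i := integrable_kmean_mul Lf Lf.
rewrite /kmean_form /Rintegral -(integral21_prod_meas1 i) fine_ge0//.
have mG := measurable_fubini_G i.
(* The inner integral is nonnegative only for almost every [s]; it is replaced by its absolute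
   value, which is so everywhere. *)
rewrite (@ae_eq_integral _ _ _ lam setT
  (abse \o fubini_G mu (fun z : T * S => (f z.1 * kmean f z)%:E)))//.
- by apply: integral_ge0 => s _ /=.
- by apply: measurableT_comp.
apply: filterS2 f0 (ae_integrable2 i) => s s0 /= intf _.
have Gfin := integrable_fin_num measurableT intf.
by rewrite gee0_abs// /fubini_G -(fineK Gfin) lee_fin.
Qed.

End reversible_family.

(** * Measures given by a weight *)

Section weighted_measure.
Context d (T : measurableType d) (R : realType).
Variables (mu nu : {measure set T -> \bar R}) (w : T -> R).
Hypotheses (mw : measurable_fun setT w) (w0 : forall x, 0 <= w x).
Local Open Scope ereal_scope.
Hypothesis nuE : forall A, measurable A ->
  nu A = \int[mu]_x (\1_A x * w x)%:E.

Let mwE : measurable_fun setT (EFin \o w).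
Proof. exact/measurable_EFinP. Qed.

(** One change of measure for all cases: [pi] and the U_t have a weight against [vol], and a
    restricted measure has an indicator as weight. *)
Lemma ge0_weighted_integral (f : T -> \bar R) : measurable_fun setT f ->
  (forall x, 0 <= f x) -> \int[nu]_x f x = \int[mu]_x (f x * (w x)%:E).
Proof.
move: f; apply: ge0_measurable_fun_ind.
- by move=> A mA; rewrite integral_indic// setIT nuE.
- move=> f g mf mg f0 g0 fE gE.
  have mfw (h : T -> \bar R) : measurable_fun setT h -> measurable_fun setT
    (fun x => h x * (w x)%:E).
    by move=> mh; exact: emeasurable_funM.
  have fw0 (h : T -> \bar R) : (forall x, 0 <= h x) -> forall x, setT x
    -> 0 <= h x * (w x)%:E.
    by move=> h0 x _; rewrite mule_ge0// lee_fin.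
  rewrite ge0_integralD// fE gE -ge0_integralD//;
    [|exact: (fw0 f)|exact: mfw|exact: (fw0 g)|exact: mfw].
  by apply: eq_integral => x _; rewrite ge0_muleDl.
- move=> a f a0 mf f0 fE; rewrite ge0_integralZl_EFin// fE.
  rewrite -ge0_integralZl_EFin//.
  + by apply: eq_integral => x _; rewrite muleA.
  + by move=> x _; rewrite mule_ge0// lee_fin.
  + exact: emeasurable_funM.
- move=> f_ mf f0 nd fE; rewrite monotone_convergence//.
  under eq_fun do rewrite fE.
  rewrite -monotone_convergence//.
  + apply: eq_integral => x _; rewrite [RHS]muleC.
    have wx0 : 0 <= (w x)%:E by rewrite lee_fin.
    rewrite -(ge0_nondecreasing_limeMl wx0 (fun n => f0 n x) (nd x)).
    by congr (limn _); apply/funext => n; rewrite muleC.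
  + by move=> n; exact: emeasurable_funM.
  + by move=> n x _; rewrite mule_ge0// lee_fin.
  + by move=> x _ a b ab; rewrite lee_wpmul2r ?lee_fin// nd.
Qed.

(** Multiplication by [w >= 0] commutes with taking positive and negative parts, so the equality
    holds even for divergent integrals. *)
Lemma weighted_integral (f : T -> R) : measurable_fun setT f ->
  \int[nu]_x (f x)%:E = \int[mu]_x (f x * w x)%:E.
Proof.
move=> mf; have mfE : measurable_fun setT (EFin \o f) by exact/measurable_EFinP.
rewrite -[LHS]/(\int[nu]_x (EFin \o f) x).
rewrite -[RHS]/(\int[mu]_x (EFin \o (fun x => (f x * w x)%R)) x).
rewrite integralE [RHS]integralE !funerpos !funerneg; congr (_ - _).
- rewrite ge0_weighted_integral//=.
  + by apply: eq_integral => x _; rewrite /funrpos -EFinM maxr_pMl ?mul0r.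
  + by apply/measurable_EFinP; exact: measurable_funrpos.
  + by move=> x; rewrite lee_fin funrpos_ge0.
- rewrite ge0_weighted_integral//=.
  + by apply: eq_integral => x _; rewrite /funrneg -EFinM maxr_pMl ?mul0r ?mulNr.
  + by apply/measurable_EFinP; exact: measurable_funrneg.
  + by move=> x; rewrite lee_fin funrneg_ge0.
Qed.

End weighted_measure.

(** * Weights of normalized measures, and membership in L2 *)

Section density_integrals.
Context d (T : measurableType d) (R : realType).
Variable mu : {measure set T -> \bar R}.
Local Open Scope ereal_scope.

Lemma normalizedE (nu : {measure set T -> \bar R}) A :
  normalized nu A = ((fine (nu setT))^-1)%:E * nu A.
Proof. by []. Qed.

Lemma normalized_density_weight (D : set T) (f : T -> R) (mD : measurable D)
    (intf : mu.-integrable D (EFin \o f)) (f0 : forall x, D x -> (0 <= f x)%R) A :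
  measurable A ->
  normalized (density mD intf f0) A =
  \int[mu]_x (\1_A x * ((fine (\int[mu]_(x in D) (f x)%:E))^-1 * (f \_ D) x)%R)%:E.
Proof.
move=> mA; rewrite normalizedE/= /density setTI.
rewrite [in X in _ * X](integral_mkcond (A `&` D)).
rewrite -ge0_integralZl_EFin//=.
- apply: eq_integral => x _; rewrite !patchE indicE in_setI.
  by case: (x \in A); case: (x \in D); rewrite /= ?mul1r ?mul0r ?mulr0 ?mule0.
- move=> x _; rewrite patchE; case: ifP => //; rewrite in_setI => /andP[_].
  by rewrite inE lee_fin; exact: f0.
- apply/(measurable_restrictT _ (measurableI _ _ mA mD)).
  by apply: measurable_funS (measurable_int _ intf).
- by rewrite invr_ge0 fine_ge0// integral_ge0// => x Dx; rewrite lee_fin f0.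
Qed.

Lemma normalized_mrestr_weight (D : set T) (mD : measurable D) A :
  measurable A ->
  normalized (mrestr mu mD) A =
  \int[mu]_x (\1_A x * ((fine (mu D))^-1 * \1_D x)%R)%:E.
Proof.
move=> mA; rewrite normalizedE/= /mrestr setTI.
rewrite -[in LHS](setIT (A `&` D)) -integral_indic//; last exact: measurableI.
rewrite -ge0_integralZl_EFin//=.
- by apply: eq_integral => x _; rewrite indicI/= -EFinM mulrCA.
- by apply/measurable_EFinP; apply: measurable_indic; exact: measurableI.
Qed.

Lemma integral_mrestr_signed (D : set T) (mD : measurable D) (f : T -> R) :
  measurable_fun setT f ->
  \int[mrestr mu mD]_x (f x)%:E = \int[mu]_(x in D) (f x)%:E.
Proof.
move=> mf; rewrite (@weighted_integral _ _ _ mu _ (\1_D))//.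
  rewrite [RHS]integral_mkcond; apply: eq_integral => x _.
  by rewrite patchE indicE; case: (x \in D); rewrite /= ?mulr1 ?mulr0.
move=> A mA; rewrite /= /mrestr -[in LHS](setIT (A `&` D)) -integral_indic//;
  last exact: measurableI.
by apply: eq_integral => x _; rewrite indicI.
Qed.

Lemma Lfun2P (f : T -> R) : f \in Lfun mu 2%:E <->
  measurable_fun setT f /\ \int[mu]_x (f x ^+ 2)%:E < +oo.
Proof.
split=> [fL|[mf foo]].
  split; first by have := sub_Lfun_mfun fL; rewrite inE.
  have /integrableP[_] := Lfun2_integrable_sqr fL.
  by under eq_integral do rewrite /= ger0_norm ?sqr_ge0//.
rewrite inE; apply/andP; split; first by rewrite inE.
rewrite inE/= /finite_norm unlock /Lnorm; apply: poweR_lty.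
by under eq_integral do rewrite /= powR_mulrn// real_normK ?num_real//.
Qed.

End density_integrals.

(** * The kernel of the slice sampler on the region under the graph *)

Section slice_kernel.
Context (R : realType) (d : nat).
Variables (K : set (d.-tuple R)) (rho : d.-tuple R -> R).
Hypotheses (mK : measurable K) (irho : (vol R d).-integrable K (EFin \o rho)).
Hypothesis rho_ge0 : forall x, K x -> 0 <= rho x.
Variable Q : R -> d.-tuple R -> {measure set (d.-tuple R) -> \bar R}.

Local Notation mu := (vol R d).
Local Notation leb := (@lebesgue_measure R).

Let mS t : measurable (superlevel K rho t) := measurable_superlevel t mK irho.

Definition slice_weight : d.-tuple R -> R := rho \_ K.

Definition slice_domain : set (d.-tuple R * R) :=
  [set xt | level K rho xt.2 /\ superlevel K rho xt.2 xt.1].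

(** The hypotheses control only the trace of [Q t x] on K(t), hence the restriction. The zero
    measure elsewhere makes the family total, so that Tonelli applies on the whole product. *)
Definition slice_kernel (z : d.-tuple R * R) : {measure set (d.-tuple R) -> \bar R} :=
  if z \in slice_domain
  then (mrestr (Q z.2 z.1) (mS z.2) : {measure set (d.-tuple R) -> \bar R})
  else (mzero : {measure set (d.-tuple R) -> \bar R}).

Lemma measurable_slice_weight : measurable_fun setT slice_weight.
Proof.
apply/(measurable_restrictT _ mK); apply/measurable_EFinP.
exact: measurable_int irho.
Qed.

Lemma slice_weight_ge0 x : 0 <= slice_weight x.
Proof. by rewrite /slice_weight patchE; case: ifP => // /set_mem; exact: rho_ge0. Qed.

Lemma integrable_slice_weight : mu.-integrable setT (EFin \o slice_weight).
Proof.
rewrite (_ : EFin \o _ = (EFin \o rho) \_ K); last first.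
  by apply/funext => x; rewrite /slice_weight /= !patchE; case: ifP.
by apply/(integrable_mkcond _ mK).
Qed.

Let subgraph : set (d.-tuple R * R) := [set xt | superlevel K rho xt.2 xt.1].

Let measurable_subgraph : measurable subgraph.
Proof.
rewrite (_ : subgraph = (K `*` setT) `&`
    (fun xt : d.-tuple R * R => slice_weight xt.1 - xt.2) @^-1` `[0, +oo[).
  apply: measurableI; first exact: measurableX.
  rewrite -[X in measurable X]setTI.
  suff : measurable_fun setT (fun xt : d.-tuple R * R => slice_weight xt.1 - xt.2).
    by apply => //; exact: measurable_itv.
  apply: measurable_funB => //.
  by apply: (measurableT_comp measurable_slice_weight).
apply/seteqP; split=> -[x t]; rewrite /subgraph /superlevel /=.
  move=> [Kx tx]; split => //.
  by rewrite in_itv/= andbT subr_ge0 /slice_weight patchE mem_set.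
move=> [[Kx _]]; rewrite in_itv/= andbT subr_ge0 /slice_weight patchE mem_set//.
Qed.

Let ysection_subgraph t : ysection subgraph t = superlevel K rho t.
Proof. by apply/seteqP; split=> x; rewrite /ysection/= inE. Qed.

(** The volume of K(t) is that of a section of a measurable set, hence measurable in [t]. *)
Lemma measurable_level : measurable (level K rho).
Proof.
rewrite (_ : level K rho = `]0, +oo[%classic `&`
   [set t | (0 < mu (ysection subgraph t))%E]).
  apply: measurableI; first exact: measurable_itv.
  rewrite -[X in measurable X]setTI.
  by apply: emeasurable_fun_o_infty => //; exact: measurable_fun_ysection.
by apply/seteqP; split=> t; rewrite /level /= ysection_subgraph in_itv/= andbT.
Qed.

Lemma measurable_slice_domain : measurable slice_domain.
Proof.
rewrite (_ : slice_domain = (setT `*` level K rho) `&` subgraph).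
  by apply: measurableI => //; apply: measurableX => //; exact: measurable_level.
by apply/seteqP; split=> -[x t] /= => [[]|[[_]]].
Qed.

(** Let [N] be the part of the subgraph over positive [t] that are not levels. Its sections at fixed
    [t] are null, as vol K(t) = 0 there; so [N] is null, and so are almost all its sections at fixed
    [x]. *)
Lemma ae_level_section :
  {ae mu, forall x, {ae leb, forall t, 0 < t <= slice_weight x -> K x
    -> level K rho t}}.
Proof.
pose N : set (d.-tuple R * R) := subgraph `&` (setT `*` (`]0, +oo[ `\` level K rho)).
have mN : measurable N.
  apply: measurableI => //; apply: measurableX => //; apply: measurableD.
    exact: measurable_itv.
  exact: measurable_level.
have N0 : (mu \x leb)%E N = 0%E.
  rewrite -[in LHS](setIT N) -integral_indic//.
  transitivity (\int[leb]_t fubini_G mu (EFin \o \1_N) t)%E.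
    apply: (@fubini_tonelli2 _ _ _ _ _ mu leb (EFin \o \1_N)).
      by apply/measurable_EFinP; exact: measurable_indic.
    by move=> z; rewrite lee_fin.
  apply: integral0_eq => t _.
  rewrite (indic_fubini_tonelli_GE mu mN)/=.
  have [[t0 nlt]|nt] := pselect ((0 < t) /\ ~ level K rho t).
    have : ysection N t `<=` superlevel K rho t.
      by move=> x; rewrite /ysection/= inE => -[].
    move=> /(@le_measure _ _ _ mu) le.
    apply/eqP; rewrite -measure_le0; apply: le_trans (le _ _) _; rewrite ?inE//.
      exact: measurable_ysection.
    by rewrite leNgt; apply/negP => S0; apply: nlt.
  rewrite (_ : ysection N t = set0) ?measure0//.
  apply/seteqP; split=> x //; rewrite /ysection/= inE => -[_ [_ []]] /=.
  by rewrite in_itv/= andbT => t0 nlt; apply: nt.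
have : {ae (mu \x leb)%E, forall z, ~ N z}.
  by exists N; split => // z /= /contrapT.
move=> /ae_product_measure1; apply: filterS => x; apply: filterS => t nN.
move=> /andP[t0 tx] Kx; apply: contrapT => nl; apply: nN; split.
  by split => //=; move: tx; rewrite /slice_weight patchE mem_set.
by split => //=; rewrite in_itv/= t0.
Qed.

(** Up to the null set of [ae_level_section], the section at [x] is the interval []0, slice_weight
    x]]. Off [K] both are empty, the weight being zero. *)
Lemma ae_slice_domain_length : {ae mu, forall x,
  \int[leb]_t (\1_slice_domain (x, t))%:E = (slice_weight x)%:E}%E.
Proof.
apply: filterS ae_level_section => x xl.
have w0 := slice_weight_ge0 x.
transitivity (\int[leb]_t (\1_(`]0, slice_weight x]%classic) t : R)%:E)%E; last first.
  rewrite integral_indic//= setIT lebesgue_measure_itv/= lte_fin.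
  by case: ltgtP w0 => [w0 _|//|<- _]; rewrite ?oppr0 ?adde0.
apply: ae_eq_integral => //.
- apply/measurable_EFinP.
  apply: (@measurableT_comp _ _ _ _ _ _ (\1_slice_domain : _ -> R)).
    exact: measurable_indic measurable_slice_domain.
  exact: pair1_measurable.
- by apply/measurable_EFinP; exact: measurable_indic.
case: xl => N [mN N0 Nsub]; exists N; split => // t /= nP.
apply: Nsub => tl; apply: nP => _; congr EFin; rewrite !indicE; congr (_%:R);
  congr nat_of_bool.
apply/idP/idP; rewrite !inE /slice_domain /superlevel /= in_itv/=.
  by move=> [[t0 _] [Kx tx]]; rewrite t0 /slice_weight patchE mem_set.
move=> tw; have Kx : K x.
  apply: contrapT => nKx; move: tw; rewrite /slice_weight patchE memNset//.
  by case/andP => t0 /(lt_le_trans t0); rewrite ltxx.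
split; first exact: tl.
by split => //; move: tw => /andP[_]; rewrite /slice_weight patchE mem_set.
Qed.

Hypothesis Q_kernel : forall t, level K rho t ->
  markov_kernel_on (superlevel K rho t) (Q t).
Hypothesis Q_reversible : forall t, level K rho t ->
  reversible (superlevel K rho t) (level_uniform mK irho t) (Q t).
Hypothesis Q_measurable : forall A, measurable A -> A `<=` K ->
  measurable_fun slice_domain
    (fun xt => Q xt.2 xt.1 (A `&` superlevel K rho xt.2)).

Let slice_kernel_in x t A : level K rho t -> superlevel K rho t x ->
  slice_kernel (x, t) A = Q t x (A `&` superlevel K rho t).
Proof. by move=> lt Sx; rewrite /slice_kernel ifT// inE; split. Qed.

Let slice_kernel_out x t A : ~ (level K rho t /\ superlevel K rho t x) ->
  slice_kernel (x, t) A = 0%E.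
Proof. by move=> nD; rewrite /slice_kernel ifF//; apply/negbTE/negP; rewrite inE. Qed.

Lemma measurable_slice_kernel U : measurable U ->
  measurable_fun setT (slice_kernel ^~ U).
Proof.
(* [Q_measurable] concerns subsets of [K]; since K(t) lies in [K], intersecting [U] with [K] changes
   nothing. *)
move=> mU; rewrite (_ : slice_kernel ^~ U =
    (fun xt => Q xt.2 xt.1 ((U `&` K) `&` superlevel K rho xt.2)) \_ slice_domain).
  apply/(measurable_restrictT _ measurable_slice_domain); apply: Q_measurable.
    exact: measurableI.
  exact: subIsetr.
apply/funext => -[x t]; rewrite patchE; case: ifPn => [|nD].
  rewrite inE => -[/= lt Sx]; rewrite slice_kernel_in// -setIA; congr (Q t x (_ `&` _)).
  by apply/seteqP; split=> y // [].
by rewrite slice_kernel_out//; move: nD; rewrite notin_setE.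
Qed.

Lemma slice_kernelT z : slice_kernel z setT = (\1_slice_domain z)%:E.
Proof.
case: z => x t; have [[lt Sx]|nD] := pselect (level K rho t /\ superlevel K rho t x).
  rewrite slice_kernel_in// setTI indicE mem_set//.
  by have [-> //] := Q_kernel lt.
by rewrite slice_kernel_out// indicE memNset.
Qed.

(** Markov's inequality for [rho]. *)
Lemma superlevel_lty t : 0 < t -> (mu (superlevel K rho t) < +oo)%E.
Proof.
move=> t0; have /integrableP[mrho rhoo] := irho.
have := le_integral_abse mu mK mrho t0.
rewrite (_ : K `&` _ = superlevel K rho t); last first.
  by apply/seteqP; split=> x /= [Kx]; rewrite lee_fin ger0_norm ?rho_ge0.
move=> le.
have le_oo : (t%:E * mu (superlevel K rho t) < +oo)%E by exact: le_lt_trans le rhoo.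
rewrite ltey; apply/eqP => E; move: le_oo.
by rewrite E gt0_muley ?lte_fin// ltxx.
Qed.

Lemma level_uniform_weight t A : measurable A ->
  level_uniform mK irho t A =
  (\int[mu]_x (\1_A x *
    ((fine (mu (superlevel K rho t)))^-1 * \1_(superlevel K rho t) x))%:E)%E.
Proof. by move=> mA; rewrite /level_uniform normalized_mrestr_weight. Qed.

Let inv_mass_gt0 t : level K rho t -> 0 < (fine (mu (superlevel K rho t)))^-1.
Proof.
by move=> [t0 S0]; rewrite invr_gt0 fine_gt0// S0 superlevel_lty.
Qed.

Let measurable_inv_mass t : measurable_fun setT (fun x =>
  (fine (mu (superlevel K rho t)))^-1 * \1_(superlevel K rho t) x).
Proof. by apply: measurable_funM => //; apply: measurable_indic; exact: mS. Qed.

Let inv_mass_ge0 t x :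
  0 <= (fine (mu (superlevel K rho t)))^-1 * \1_(superlevel K rho t) x.
Proof. by rewrite mulr_ge0// invr_ge0 fine_ge0. Qed.

Lemma slice_kernel_sym A B : measurable A -> measurable B ->
  (\int[mu \x leb]_z ((\1_A z.1)%:E * slice_kernel z B) =
   \int[mu \x leb]_z ((\1_B z.1)%:E * slice_kernel z A))%E.
Proof.
have m1k C C' : measurable C -> measurable C' ->
    measurable_fun setT (fun z : d.-tuple R * R => (\1_C z.1)%:E * slice_kernel z C')%E.
  move=> mC mC'; apply: emeasurable_funM; last exact: measurable_slice_kernel.
  apply/measurable_EFinP; apply: (@measurableT_comp _ _ _ _ _ _ (\1_C : _ -> R)).
    exact: measurable_indic.
  exact: measurable_fst.
have k0 C C' (z : d.-tuple R * R) : (0 <= (\1_C z.1)%:E * slice_kernel z C')%E.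
  by rewrite mule_ge0// lee_fin.
have FT C C' (mC : measurable C) (mC' : measurable C') :
    (\int[mu \x leb]_z ((\1_C z.1)%:E * slice_kernel z C') = \int[leb]_t
      fubini_G mu (fun z => (\1_C z.1)%:E * slice_kernel z C') t)%E.
  exact: (@fubini_tonelli2 _ _ _ _ _ mu leb _ (m1k _ _ mC mC') (k0 C C')).
move=> mA mB; rewrite (FT _ _ mA mB) (FT _ _ mB mA).
apply: eq_integral => t _; rewrite /fubini_G /=.
have [lt|nlt] := pselect (level K rho t); last first.
  by rewrite !integral0_eq// => x _; rewrite slice_kernel_out ?mule0// => -[].
have := Q_reversible lt
  (measurableI _ _ mA (mS t)) (measurableI _ _ mB (mS t)) (@subIsetr _ _ _)
    (@subIsetr _ _ _).
set c := (fine (mu (superlevel K rho t)))^-1.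
have c0 : 0 < c by exact: inv_mass_gt0.
(* Passing from U_t to [vol] costs the factor [c]. It is the same on both sides of the reversibility
   identity and positive, so it cancels. *)
have E C C' : measurable C -> measurable C' ->
    (\int[level_uniform mK irho t]_(x in C `&` superlevel K rho t)
       Q t x (C' `&` superlevel K rho t) =
     c%:E * \int[mu]_x ((\1_C x)%:E * slice_kernel (x, t) C'))%E.
  move=> mC mC'; rewrite integral_mkcond.
  have mCS : measurable (C `&` superlevel K rho t) by exact: measurableI (mS t).
  rewrite (ge0_weighted_integral (measurable_inv_mass t) (inv_mass_ge0 t)
    (@level_uniform_weight t)).
  - rewrite -ge0_integralZl_EFin//; last 2 first.
    + by apply: (measurableT_comp (m1k _ _ mC mC') (pair2_measurable t)).
    + exact: ltW.
    apply: eq_integral => x _; rewrite patchE in_setI.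
    have [Sx|nSx] := pselect (superlevel K rho t x); last first.
      rewrite (memNset nSx) andbF mul0e slice_kernel_out ?mule0// => -[_]; exact: nSx.
    rewrite [in RHS]slice_kernel_in// !indicE.
    rewrite (mem_set Sx) andbT mulr1.
    by case: (x \in C); rewrite ?mul0e ?mule0// mul1e muleC.
  - apply/(measurable_restrictT _ mCS).
    have [_ mQ] := Q_kernel lt.
    have mC'S : measurable (C' `&` superlevel K rho t) by exact: measurableI (mS t).
    by apply: measurable_funS (mS t) _ (mQ _ mC'S _) => //; exact: subIsetr.
  - by move=> x; rewrite patchE; case: ifP.
rewrite !E// => /(congr1 (fun u => (c^-1)%:E * u)%E).
by rewrite !muleA -EFinM mulVf ?gt_eqF// !mul1e.
Qed.

Lemma slice_kmeanE f x t : measurable_fun setT f ->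
  kmean slice_kernel f (x, t) =
  if (x, t) \in slice_domain then \int[Q t x]_(y in superlevel K rho t) f y else 0.
Proof.
move=> mf; rewrite /kmean /Rintegral /slice_kernel; case: ifP => _ /=.
  by rewrite (integral_mrestr_signed _ (mS t)).
by rewrite integral_measure_zero.
Qed.

(** The equality holds at every point: off [K] the inverse of the zero weight is zero, in agreement
    with the restriction to [K]. *)
Lemma slice_samplerE f : measurable_fun setT f ->
  slice_sampler K rho Q f = averaged leb slice_kernel slice_weight f.
Proof.
move=> mf; apply/funext => x; rewrite /slice_sampler patchE /averaged.
case: ifPn => [Kx|nKx]; last first.
  by rewrite /slice_weight patchE (negbTE nKx) invr0 mul0r.
rewrite /slice_weight patchE Kx; congr (_ * _);
  rewrite /kmean_section [LHS]Rintegral_mkcond.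
apply: eq_Rintegral => t _; rewrite patchE.
(* the carrier of [leb] is only convertible to [R] *)
rewrite -[RHS]/(kmean slice_kernel f (x, t : R)) slice_kmeanE//.
congr (if _ then _ else _); apply/idP/idP; rewrite !inE /slice_domain /= in_itv/=.
  by move=> [/andP[t0 tx] lt]; split => //; split => //; exact: set_mem.
by move=> [[t0 S0] [_ tx]]; rewrite t0 tx.
Qed.

Lemma slice_kernel_integrable f x t : measurable_fun setT f ->
  level K rho t -> superlevel K rho t x ->
  (slice_kernel (x, t)).-integrable setT (EFin \o f) ->
  (Q t x).-integrable (superlevel K rho t) (EFin \o f).
Proof.
move=> mf lt Sx /integrableP[_].
rewrite /slice_kernel ifT ?inE//= => foo; apply/integrableP; split.
  by apply: measurable_funS (measurableT) _ _ => //; exact/measurable_EFinP.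
rewrite -(integral_mrestr_signed (Q t x) (mS t)) //.
exact: measurableT_comp.
Qed.

End slice_kernel.

(** * The target measure and its L2 space *)

Section target.
Context (R : realType) (d : nat).
Variables (K : set (d.-tuple R)) (rho : d.-tuple R -> R).
Hypotheses (mK : measurable K) (irho : (vol R d).-integrable K (EFin \o rho)).
Hypothesis rho_ge0 : forall x, K x -> 0 <= rho x.
Hypothesis rho_gt0 : (0 < \int[vol R d]_(x in K) (rho x)%:E)%E.

Local Notation mu := (vol R d).
Local Notation r := (slice_weight K rho).
Local Notation pi := (target mK irho rho_ge0).

Definition total_mass : R := fine (\int[mu]_(x in K) (rho x)%:E)%E.

Let mr : measurable_fun setT r := measurable_slice_weight mK irho.
Let r0 x : 0 <= r x := slice_weight_ge0 rho_ge0 x.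

Lemma total_mass_gt0 : 0 < total_mass.
Proof.
rewrite /total_mass fine_gt0// rho_gt0 /=.
by have := integrable_lty mK irho.
Qed.

Let w x : R := total_mass^-1 * r x.

Let mw : measurable_fun setT w.
Proof. exact: measurable_funM. Qed.

Let w0 x : 0 <= w x.
Proof. by rewrite mulr_ge0// invr_ge0 ltW// total_mass_gt0. Qed.

Let target_weight A : measurable A -> pi A = (\int[mu]_x (\1_A x * w x)%:E)%E.
Proof. by move=> mA; rewrite /target normalized_density_weight. Qed.

Lemma target_ge0_integral (f : d.-tuple R -> \bar R) : measurable_fun setT f ->
  (forall x, 0 <= f x)%E ->
  (\int[mu]_x (f x * (r x)%:E) = total_mass%:E * \int[pi]_x f x)%E.
Proof.
move=> mf f0; rewrite (ge0_weighted_integral mw w0 target_weight)//.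
have c0 := total_mass_gt0.
rewrite -ge0_integralZl_EFin//; last 2 first.
- by apply: emeasurable_funM => //; exact/measurable_EFinP.
- exact: ltW.
  apply: eq_integral => x _; rewrite muleCA /w -EFinM mulrA mulfV ?gt_eqF//.
  by rewrite mul1r.
by move=> x _; rewrite mule_ge0// lee_fin.
Qed.

Lemma target_Lfun2P f : f \in Lfun pi 2%:E <-> weighted_L2 mu r f.
Proof.
have c0 := total_mass_gt0.
rewrite Lfun2P /weighted_L2.
have E : measurable_fun setT f -> (\int[mu]_x (f x ^+ 2 * r x)%:E =
    total_mass%:E * \int[pi]_x (f x ^+ 2)%:E)%E.
  move=> mf; rewrite -target_ge0_integral//.
    by apply/measurable_EFinP; exact: measurable_funX.
  by move=> x; rewrite lee_fin sqr_ge0.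
split=> -[mf foo]; split => //; first by rewrite E// lte_mul_pinfty// lee_fin ltW.
rewrite ltey; apply/eqP => foo'; move: foo; rewrite E// foo' gt0_muley ?lte_fin//.
Qed.

(** Points with [r x <= 0] carry no mass of [pi] and are added to the exceptional set. *)
Lemma target_ae (P : d.-tuple R -> Prop) :
  {ae mu, forall x, 0 < r x -> P x} -> {ae pi, forall x, P x}.
Proof.
move=> [N [mN N0 PN]].
have mr0 : measurable [set x | r x <= 0].
  rewrite (_ : mkset _ = r @^-1` `]-oo, 0]).
    by rewrite -[X in measurable X]setTI; apply: mr => //; exact: measurable_itv.
  by apply/seteqP; split=> x /=; rewrite in_itv.
exists (N `|` [set x | r x <= 0]); split.
- exact: measurableU.
- rewrite target_weight; last exact: measurableU.
  rewrite (@ae_eq_integral _ _ _ mu setT (cst 0%E)) ?integral0//.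
    apply/measurable_EFinP; apply: measurable_funM => //.
    by apply: measurable_indic; exact: measurableU.
  exists N; split => // x /= nE; apply: contrapT => nN; apply: nE => _.
  rewrite /w indicE; have [xr|rx] := leP (r x) 0.
    by rewrite (_ : r x = 0) ?mulr0//; apply/eqP; rewrite eq_le xr r0.
  rewrite memNset ?mul0r// => -[//|/=]; by rewrite leNgt rx.
- move=> x /= nP; have [xr|rx] := leP (r x) 0; first by right.
  by left; apply: PN => /(_ rx).
Qed.

Lemma target_null N : measurable N -> pi N = 0%E ->
  (\int[mu]_x ((\1_N x)%:E * (r x)%:E) = 0)%E.
Proof.
move=> mN N0; rewrite (target_ge0_integral (f := EFin \o \1_N))//.
- by rewrite integral_indic// setIT N0 mule0.
- by apply/measurable_EFinP; exact: measurable_indic.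
- by move=> x; rewrite lee_fin.
Qed.

Lemma integrable_weighted_mul f g : weighted_L2 mu r f -> weighted_L2 mu r g ->
  mu.-integrable setT (fun x => (f x * g x * r x)%:E).
Proof.
move=> [mf foo] [mg goo].
have ij (h : d.-tuple R -> R) : measurable_fun setT h ->
    (\int[mu]_x (h x ^+ 2 * r x)%:E < +oo)%E ->
    mu.-integrable setT (fun x => (h x ^+ 2 * r x)%:E).
  move=> mh hoo; apply/integrableP; split.
    by apply/measurable_EFinP; apply: measurable_funM => //; exact: measurable_funX.
  rewrite (eq_integral (fun x => (h x ^+ 2 * r x)%:E))// => x _.
  by rewrite gee0_abs// lee_fin mulr_ge0// sqr_ge0.
apply: (le_integrable measurableT) (integrableD measurableT (ij _ mf foo)
  (ij _ mg goo)).
  by apply/measurable_EFinP; apply: measurable_funM => //; exact: measurable_funM.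
move=> x _; rewrite /= lee_fin -mulrDl !normrM [ `|r x|]ger0_norm//.
rewrite ler_wpM2r// [leRHS]ger0_norm ?addr_ge0 ?sqr_ge0// -normrM ler_norml.
by have := sqr_ge0 (f x + g x); have := sqr_ge0 (f x - g x);
   move=> *; apply/andP; split; nra.
Qed.

Lemma target_inner f g : weighted_L2 mu r f -> weighted_L2 mu r g ->
  inner pi f g = total_mass^-1 * \int[mu]_x (f x * g x * r x).
Proof.
move=> Lf Lg; rewrite -RintegralZl//; last exact: integrable_weighted_mul.
have [mf _] := Lf; have [mg _] := Lg.
rewrite /inner /Rintegral (weighted_integral mw w0 target_weight);
  last exact: measurable_funM.
by congr fine; apply: eq_integral => x _; rewrite /w mulrCA.
Qed.

End target.

(** * Positivity at a fixed level *)

Section level_positivity.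
Context (R : realType) (d : nat).
Variables (K : set (d.-tuple R)) (rho : d.-tuple R -> R).
Hypotheses (mK : measurable K) (irho : (vol R d).-integrable K (EFin \o rho)).
Hypothesis rho_ge0 : forall x, K x -> 0 <= rho x.
Variable Q : R -> d.-tuple R -> {measure set (d.-tuple R) -> \bar R}.
Hypothesis Q_positive : forall t, level K rho t ->
  nonneg_form (level_uniform mK irho t)
    (markov_operator (superlevel K rho t) (Q t)).
Hypothesis Q_measurable : forall A, measurable A -> A `<=` K ->
  measurable_fun (slice_domain K rho)
    (fun xt => Q xt.2 xt.1 (A `&` superlevel K rho xt.2)).

Local Notation mu := (vol R d).
Local Notation k := (slice_kernel mK irho Q).

(** At a level [t] the integral is vol K(t) times the form of R_t on L2(U_t): the mean vanishes off
    K(t), so there the weight of U_t acts as the constant [c]. At any other [t] it is zero. *)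
Lemma slice_form_ge0 (f : d.-tuple R -> R) (t : R) : measurable_fun setT f ->
  (\int[mu]_x ((f x ^+ 2)%:E * (\1_(slice_domain K rho) (x, t))%:E) < +oo)%E ->
  mu.-integrable setT (fun x => (f x * kmean k f (x, t))%:E) ->
  0 <= \int[mu]_x (f x * kmean k f (x, t)).
Proof.
move=> mf foo ifk; have [lt|nlt] := pselect (level K rho t); last first.
  rewrite (@eq_Rintegral _ _ _ mu setT (cst 0)) ?Rintegral_cst ?mul0r// => x _.
  rewrite slice_kmeanE// ifF ?mulr0//.
  by apply/negbTE/negP; rewrite inE => -[].
set S := superlevel K rho t in foo *.
have mS : measurable S := measurable_superlevel t mK irho.
pose c := (fine (mu S))^-1.
have c0 : 0 < c.
  have [t0 S0] := lt.
  by rewrite invr_gt0 fine_gt0// S0 (superlevel_lty mK irho rho_ge0 t0).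
have mw : measurable_fun setT (fun x => c * \1_S x : R).
  by apply: measurable_funM => //; exact: measurable_indic.
have w0 x : 0 <= c * \1_S x :> R by rewrite mulr_ge0// ltW.
have wE := @level_uniform_weight _ _ _ _ mK irho t.
have DE x : ((x, t) \in slice_domain K rho) = (x \in S).
  by apply/idP/idP; rewrite !inE; [case|split].
have kE : markov_operator S (Q t) f = fun x => kmean k f (x, t).
  by apply/funext => x; rewrite /markov_operator patchE slice_kmeanE// DE.
have fL : f \in Lfun (level_uniform mK irho t) 2%:E.
  apply/Lfun2P; split => //; rewrite (weighted_integral mw w0 wE);
    last exact: measurable_funX.
  rewrite (_ : (\int[mu]_x _)%E = (c%:E * \int[mu]_x ((f x ^+ 2)%:E *
      (\1_(slice_domain K rho) (x, t))%:E))%E).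
    by rewrite lte_mul_pinfty// lee_fin ltW.
  rewrite -ge0_integralZl_EFin//; last 3 first.
  - by move=> x _; rewrite mule_ge0// lee_fin sqr_ge0.
  - apply: emeasurable_funM.
      by apply/measurable_EFinP; exact: measurable_funX.
    under eq_fun do rewrite indicE DE -indicE.
    by apply/measurable_EFinP; exact: measurable_indic.
  - exact: ltW.
  by apply: eq_integral => x _; rewrite !indicE DE -!EFinM mulrCA.
have := Q_positive lt fL; rewrite kE /inner.
have mkf : measurable_fun setT (fun x => kmean k f (x, t)).
  apply: (measurableT_comp _ (pair2_measurable t)).
  apply: measurable_Rintegral_kernel => //.
  exact: (measurable_slice_kernel mK irho Q_measurable).
rewrite /Rintegral (weighted_integral mw w0 wE); last exact: measurable_funM.
rewrite -/(Rintegral _ _ _).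
rewrite (_ : fine _ = c * \int[mu]_x (f x * kmean k f (x, t))).
  by rewrite pmulr_rge0.
rewrite -RintegralZl//; apply: eq_Rintegral => x _.
rewrite slice_kmeanE// DE indicE; case: (x \in S) => /=.
  by rewrite mulr1 mulrC [f x * _]mulrC.
by rewrite !mulr0.
Qed.

End level_positivity.

(** * The slice sampler is defined and positive on L2(pi) *)

Theorem mainTheorem3 (R : realType) (d : nat)
    (K : set (d.-tuple R)) (mK : measurable K) (intK : has_interior K)
    (rho : d.-tuple R -> R)
    (rho_ge0 : forall x, K x -> 0 <= rho x)
    (irho : (vol R d).-integrable K (EFin \o rho))
    (rho_gt0 : (0 < \int[vol R d]_(x in K) (rho x)%:E)%E)
    (Q : R -> d.-tuple R -> {measure set (d.-tuple R) -> \bar R})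
    (Q_kernel : forall t, level K rho t ->
      markov_kernel_on (superlevel K rho t) (Q t))
    (Q_reversible : forall t, level K rho t ->
      reversible (superlevel K rho t) (level_uniform mK irho t) (Q t))
    (Q_positive : forall t, level K rho t ->
      nonneg_form (level_uniform mK irho t)
        (markov_operator (superlevel K rho t) (Q t)))
    (Q_measurable : forall A, measurable A -> A `<=` K ->
      measurable_fun
        [set xt : d.-tuple R * R |
          level K rho xt.2 /\ superlevel K rho xt.2 xt.1]
        (fun xt => Q xt.2 xt.1 (A `&` superlevel K rho xt.2))) :
  let pi := target mK irho rho_ge0 in
  (forall f, f \in Lfun pi 2%:E ->
     {ae pi, forall x, slice_sampler_defined K rho Q f x}) /\
  positive_operator pi (slice_sampler K rho Q).

Proof.
move=> pi.
have mr := measurable_slice_weight mK irho.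
have r0 := slice_weight_ge0 rho_ge0.
have ir := integrable_slice_weight mK irho.
have mD := measurable_slice_domain mK irho.
have rD := ae_slice_domain_length mK irho rho_ge0.
have mk := measurable_slice_kernel mK irho Q_measurable.
have kT := slice_kernelT mK irho Q_kernel.
have ksym := slice_kernel_sym rho_ge0 Q_kernel Q_reversible Q_measurable.
have c0 := total_mass_gt0 mK irho rho_gt0.
have L2P f := target_Lfun2P mK irho rho_ge0 rho_gt0 f.
have mf_of f : f \in Lfun pi 2%:E -> measurable_fun setT f by move=> /L2P[].
have avgE f : f \in Lfun pi 2%:E -> slice_sampler K rho Q f =
    averaged lebesgue_measure (slice_kernel mK irho Q) (slice_weight K rho) f.
  by move=> /mf_of; exact: slice_samplerE.
have avgL f : f \in Lfun pi 2%:E -> slice_sampler K rho Q f \in Lfun pi 2%:E.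
  move=> fL; rewrite avgE//; apply/L2P.
  by apply: (weighted_L2_averaged
    (lam := lebesgue_measure) mk mD kT ksym mr r0 ir rD); exact/L2P.
have formE f g : f \in Lfun pi 2%:E -> g \in Lfun pi 2%:E ->
    inner pi (slice_sampler K rho Q f) g =
    (total_mass K rho)^-1 * kmean_form (vol R d) lebesgue_measure
      (slice_kernel mK irho Q) f g.
  move=> fL gL; rewrite target_inner//; [|exact/L2P/avgL|exact/L2P].
  rewrite avgE// (averaged_form
    (lam := lebesgue_measure) mk mD kT ksym mr r0 ir rD)//; exact/L2P.
split.
  move=> f fL; have /L2P Lf := fL; have mf := mf_of _ fL.
  apply: (target_ae mK irho rho_ge0).
  have H1 := ae_product_measure1 (ae_integrable_kernel
    (lam := lebesgue_measure) mk mD kT ksym mr r0 rD Lf).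
  have H2 := ae_integrable_section
    (lam := lebesgue_measure) mk mD kT ksym mr r0 ir rD Lf.
  have H3 := ae_level_section mK irho.
  apply: filterS3 H1 H2 H3 => x H1 H2 H3 rx.
  have Kx : K x.
    apply: contrapT => nKx; move: rx; rewrite /slice_weight patchE memNset//.
    by rewrite ltxx.
  have rE : slice_weight K rho x = rho x by rewrite /slice_weight patchE mem_set.
  rewrite rE in rx H3.
  split => //.
    (* At a [t] that is not a level the kernel is zero, and its integrability says nothing about
       [Q t x]. The two null sets are therefore joined, and the level condition is settled first. *)
    case: H1 H3 => N1 [mN1 N10 PN1] [N3 [mN3 N30 PN3]].
    exists (N1 `|` N3); split; first exact: measurableU.
      have N13 : (lebesgue_measure N1 + lebesgue_measure N3 <= 0)%E.
        by rewrite N10 N30 adde0.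
      by apply/eqP; rewrite -measure_le0; exact: le_trans (measureU2 _ mN1 mN3) N13.
    move=> t /= nP; apply: contrapT => /not_orP[nN1 nN3]; apply: nP.
    rewrite in_itv/= => t0x.
    have lt : level K rho t by apply: contrapT => nl; apply: nN3;
      apply: PN3 => /(_ t0x Kx).
    have Sx : superlevel K rho t x by split => //; case/andP: t0x.
    split => //; apply: (slice_kernel_integrable mf lt Sx).
    by apply: contrapT => ni; apply: nN1; exact: PN1.
  have mdom : measurable (`]0, rho x]%classic `&` level K rho : set R).
    by apply: measurableI; [exact: measurable_itv|exact: measurable_level mK irho].
  apply: (@integrable_mkcond _ _ R (@lebesgue_measure R) _ _ mdom).2; move: H2;
    apply: eq_integrable => // t _ /=.
  rewrite -[kmean _ _ _]/(kmean (slice_kernel mK irho Q) f (x, t : R)).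
  rewrite slice_kmeanE// patchE.
  rewrite (_ : (t \in _) = ((x, t) \in slice_domain K rho)); first by case: ifP.
  apply/idP/idP; rewrite !inE /slice_domain /= in_itv/=.
    by move=> [/andP[t0 tx] lt].
  by move=> [[t0 S0] [_ tx]]; rewrite t0 tx.
split; last first.
  move=> f fL; have /L2P Lf := fL; have mf := mf_of _ fL.
  rewrite formE// mulr_ge0//; first by rewrite invr_ge0 ltW.
  apply: (kmean_form_ge0 (lam := lebesgue_measure) mk mD kT ksym mr r0 rD Lf).
  have H1 := ae_section_L2 (lam := lebesgue_measure) mD mr r0 rD Lf.
  have H2 := ae_integrable2 (integrable_kmean_mul
    (lam := lebesgue_measure) mk mD kT ksym mr r0 rD Lf Lf).
  apply: filterS2 H1 H2 => t.
  exact: slice_form_ge0.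
split.
- exact: avgL.
- move=> f g fL gL [N [mN N0 PN]].
  rewrite !avgE//; have mf := mf_of _ fL; have mg := mf_of _ gL.
  (* The set where [f] and [g] differ is itself measurable and [pi]-null, so its indicator can be
     integrated in [ae_averaged_eq]. *)
  have mE := measurable_neq_fun mf mg.
  have E0 : pi [set x | f x != g x] = 0%E.
    apply/eqP; rewrite -measure_le0 -N0 le_measure ?inE// => x /= /eqP fg.
    by apply: PN => /= /(_ I).
  have := ae_averaged_eq (lam := lebesgue_measure) mk mD kT ksym mr r0 rD mf mg
    (target_null rho_gt0 mE E0).
  move=> H; apply: (target_ae mK irho rho_ge0).
  by apply: filterS H => x xE _ _.
- move=> a f g fL gL.
  have afgL : (a \*o f \+ g) \in Lfun pi 2%:E.
    rewrite (_ : _ \+ _ = (a \o* f) \+ g); last first.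
      by apply/funext => x; rewrite /= mulrC.
    have p1 : (1 <= 2%:E :> \bar R)%E by rewrite lee_fin ler1n.
    by apply: (Lfun_addr_closed pi p1).2 => //; apply: Lfun_scale; rewrite ?ler1n.
  rewrite (avgE _ afgL) (avgE _ fL) (avgE _ gL).
  have H := ae_averaged_linear (lam := lebesgue_measure) mk mD kT ksym mr r0 ir rD a
    ((L2P _).1 fL) ((L2P _).1 gL).
  apply: (target_ae mK irho rho_ge0).
  by apply: filterS H => x xE _ _.
- move=> f g fL gL; rewrite formE//.
  rewrite (_ : inner pi f _ = inner pi (slice_sampler K rho Q g) f); last first.
    by apply: eq_Rintegral => x _; rewrite mulrC.
  rewrite formE//; congr (_ * _).
  by apply: (kmean_formC (lam := lebesgue_measure) mk mD kT ksym mr r0 rD); exact/L2P.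
Qed.
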